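(* Let $P(t)$, $t\in[0,D]$, be the optimal policy and $T(t)$ the resulting temperature. If there is a discontinuity in $P(t)$, it is a positive jump (the right limit exceeds the left limit) and it occurs only at the energy arrival instants $s_1,\dots,s_N$. The temperature $T(t)$ is continuous throughout the interval $[0,D]$.
   Context: Fix a deadline $D>0$, constants $a,b>0$, an environment temperature $T_e$ and a critical temperature $T_c>T_e$; set $T_\delta=T_c-T_e$. Energy amounts $E_0,E_1,\dots,E_N>0$ become available at times $0=s_0<s_1<\dots<s_N<D$ respectively, and $s_{N+1}=D$. The instants $s_1,\dots,s_N$ are the energy arrival (harvesting) instants. For $t\in(0,D]$ let $h(t)=\max\{k: s_k<t\}$. A power policy is a measurable function $P:[0,D]\to[0,\infty)$. The resulting temperature $T(t)$ solves $\frac{d}{dt}T(t)=aP(t)-b(T(t)-T_e)$, $T(0)=T_e$, i.e. $T(t)=T_e+e^{-bt}\int_0^t ae^{b\tau}P(\tau)\,d\tau$. The optimal policy is the maximizer of $\int_0^D\frac12\log_2(1+P(\tau))\,d\tau$ over power policies satisfying the temperature constraint $T(t)\le T_c$ for all $t\in[0,D]$ (equivalently $\int_0^t ae^{b\tau}P(\tau)\,d\tau\le T_\delta e^{bt}$ for all $t$) and the energy causality constraint $\int_0^tP(\tau)\,d\tau\le\sum_{i=0}^{h(t)}E_i$ for all $t\in(0,D]$. It is unique almost everywhere; pointwise statements about it are understood after modification on a null set. *)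

(* Defs.v *)
From mathcomp Require Import all_boot all_order all_algebra.
From mathcomp Require Import all_classical all_reals all_analysis.

Set Implicit Arguments.
Unset Strict Implicit.
Unset Printing Implicit Defensive.

Import Order.TTheory GRing.Theory Num.Theory.
Import numFieldTopology.Exports numFieldNormedType.Exports.

Local Open Scope classical_set_scope.
Local Open Scope ring_scope.

Definition power_policy (R : realType) (D : R) (P : R -> R) : Prop :=
  measurable_fun `[0, D] P /\ (forall t, t \in `[0, D] -> 0 <= P t).

(* The real-valued integral would be 0 if P were not integrable on [0, t]; for
   policies satisfying [energy_causal] (an extended-real inequality) this does
   not happen. *)
Definition temperature (R : realType) (a b Te : R) (P : R -> R) (t : R) : R :=
  Te + expR (- (b * t)) *
    \int[lebesgue_measure]_(u in `[0, t]) (a * expR (b * u) * P u).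

(* max {k <= N : s k < t}; the index N + 1 is never needed since s (N + 1) = D
   and t <= D. *)
Definition last_arrival (R : realType) (N : nat) (s : nat -> R) (t : R) : nat :=
  (\max_(k < N.+1 | (s k < t)%R) k)%N.

Definition energy_causal (R : realType) (D : R) (N : nat) (s E : nat -> R)
    (P : R -> R) : Prop :=
  forall t, t \in `]0, D] ->
    (\int[lebesgue_measure]_(u in `[0%R, t]) (P u)%:E
      <= (\sum_(i < (last_arrival N s t).+1) E i)%:E)%E.

Definition feasible (R : realType) (D a b Te Tc : R) (N : nat) (s E : nat -> R)
    (P : R -> R) : Prop :=
  [/\ power_policy D P,
      forall t, t \in `[0, D] -> temperature a b Te P t <= Tc
    & energy_causal D N s E P].

Definition throughput (R : realType) (D : R) (P : R -> R) : \bar R :=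
  (\int[lebesgue_measure]_(u in `[0%R, D])
     (2^-1 * (ln (1 + P u) / ln 2))%:E)%E.

Definition optimal_policy (R : realType) (D a b Te Tc : R) (N : nat)
    (s E : nat -> R) (P : R -> R) : Prop :=
  feasible D a b Te Tc N s E P /\
  forall P', feasible D a b Te Tc N s E P' ->
    (throughput D P' <= throughput D P)%E.

(* Continuity is relative to [0, D], hence one-sided at 0 and D. *)
Definition discontinuous_at (R : realType) (D : R) (f : R -> R) (t : R) : Prop :=
  t \in `[0, D] /\ ~ (f x @[x --> within `[0, D] (nbhs t)] --> f t).

Definition positive_jump (R : realType) (f : R -> R) (t : R) : Prop :=
  exists l r : R,
    [/\ f x @[x --> t^'-] --> l, f x @[x --> t^'+] --> r & l < r].

(* Main.v *)
Require Import Defs.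
From mathcomp Require Import all_boot all_order all_algebra.
From mathcomp Require Import all_classical all_reals all_analysis.
From mathcomp Require Import measurable_realfun ring lra.

(* Everything follows from two exchanges of power between a measurable set A
   (which gives) and a measurable set B (which receives).

   Delaying: moving power from A to a later B with the weight exp (- b t) keeps
   the final heat, lowers the heat in between, and lowers the energy used at
   all times, so it is always feasible. Optimality then forces
   exp (b t) * (1 + P t) to be nondecreasing off a null set: P has one-sided
   limits and can only jump upwards.

   Advancing: moving power with weight 1 from A to an earlier B inside one
   inter-arrival interval is feasible wherever T < Tc, so P cannot jump upwards
   there. If T t0 = Tc, then comparing T with Tc on both sides of t0 gives
   a P(t0-) >= b (Tc - Te) >= a P(t0+), which also excludes an upward jump.
   The same two facts show that P stays bounded near D. *)

Set Implicit Arguments.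
Unset Strict Implicit.
Unset Printing Implicit Defensive.

Import Order.TTheory GRing.Theory Num.Theory.
Import numFieldTopology.Exports numFieldNormedType.Exports.

Local Open Scope classical_set_scope.
Local Open Scope ring_scope.

(** * Transferring power between two sets *)

Section integrals.
Context {R : realType}.
Local Notation mu := (@lebesgue_measure R).

Lemma itv_measure_lty (x y : R) (A : set R) : measurable A ->
  A `<=` `[x, y] -> (mu A < +oo)%E.
Proof.
move=> mA Axy; apply: (@le_lt_trans _ _ (mu `[x, y])).
  by apply: le_measure => //; rewrite inE.
by rewrite lebesgue_measure_itv/=; case: ifP => _; rewrite ?ltry.
Qed.

Lemma itv_bounded_integrable (x y M : R) (f : R -> R) :
  measurable_fun `[x, y] f -> (forall u, u \in `[x, y] -> `|f u| <= M) ->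
  mu.-integrable `[x, y] (EFin \o f).
Proof.
move=> mf fM; apply: measurable_bounded_integrable => //.
  exact: (@itv_measure_lty x y).
by exists M; split; [exact: num_real|] => N MN u /fM /le_trans; apply; exact: ltW.
Qed.

Lemma Rintegral_indic (x y : R) (A : set R) : measurable A ->
  \int[mu]_(u in `[x, y]) \1_A u = fine (mu (A `&` `[x, y])).
Proof. by move=> mA; rewrite /Rintegral integral_indic. Qed.

(** Dominated by [f], because ln (1 + x) <= x. *)
Lemma ln1D_integrable (A : set R) (f : R -> R) : measurable A ->
  (forall u, A u -> 0 <= f u) -> mu.-integrable A (EFin \o f) ->
  mu.-integrable A (EFin \o (fun u => ln (1 + f u))).
Proof.
move=> mA f0 intf; apply: (le_integrable _ _ _ intf) => //.
  apply/measurable_EFinP; apply: measurableT_comp => //.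
  apply: measurable_funD => //.
  by apply/measurable_EFinP; exact: (measurable_int mu).
move=> u Au /=; rewrite lee_fin ger0_norm ?ln_ge0 ?lerDl ?f0//.
by rewrite (ger0_norm (f0 _ Au)) le_ln1Dx// (lt_le_trans _ (f0 _ Au)).
Qed.

Lemma fine_measure_gt0 (x y : R) (A : set R) : measurable A ->
  A `<=` `[x, y] -> (0 < mu A)%E -> 0 < fine (mu A).
Proof. by move=> mA Axy A0; rewrite fine_gt0// A0/=; exact: itv_measure_lty Axy. Qed.

Lemma add_integrable (A : set R) (f g : R -> R) : measurable A ->
  mu.-integrable A (EFin \o f) -> mu.-integrable A (EFin \o g) ->
  mu.-integrable A (EFin \o (fun u => f u + g u)).
Proof. by move=> mA intf intg; exact: (@integrableD _ _ _ mu A mA _ _ intf intg). Qed.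

Lemma sub_integrable (A : set R) (f g : R -> R) : measurable A ->
  mu.-integrable A (EFin \o f) -> mu.-integrable A (EFin \o g) ->
  mu.-integrable A (EFin \o (fun u => f u - g u)).
Proof. by move=> mA intf intg; exact: (@integrableB _ _ _ mu A mA _ _ intf intg). Qed.

(** Each set is normalised to unit mass, so adding [eps * transfer A B] to a policy moves the amount
    [eps] from [A] to [B] and keeps the total. *)
Definition transfer (A B : set R) (u : R) : R :=
  \1_B u / fine (mu B) - \1_A u / fine (mu A).

Section transfer.
Variables (D : R) (A B : set R).
Hypotheses (mA : measurable A) (mB : measurable B).
Hypotheses (AD : A `<=` `[0, D]) (BD : B `<=` `[0, D]).
Hypotheses (A_gt0 : (0 < mu A)%E) (B_gt0 : (0 < mu B)%E).

Let fA_gt0 : 0 < fine (mu A).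
Proof. exact: fine_measure_gt0 AD A_gt0. Qed.

Let fB_gt0 : 0 < fine (mu B).
Proof. exact: fine_measure_gt0 BD B_gt0. Qed.

Lemma measurable_transfer (S : set R) : measurable_fun S (transfer A B).
Proof.
by apply: measurable_funB; apply: measurable_funM => //; exact: measurable_indic.
Qed.

Lemma transfer_bounded u :
  `|transfer A B u| <= (fine (mu A))^-1 + (fine (mu B))^-1.
Proof.
have indic (C : set R) : 0 < fine (mu C) ->
    `|\1_C u / fine (mu C)| <= (fine (mu C))^-1.
  move=> C_gt0; rewrite normrM indicE normr_nat gtr0_norm ?invr_gt0//.
  by rewrite ler_piMl ?invr_ge0 ?(ltW C_gt0)// lern1 leq_b1.
by rewrite /transfer addrC (le_trans (ler_normD _ _))// normrN lerD ?indic.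
Qed.

Lemma indicM_integrable (C : set R) (c x y : R) : measurable C ->
  mu.-integrable `[x, y] (EFin \o (fun u => \1_C u * c)).
Proof.
move=> mC; apply: (@itv_bounded_integrable _ _ `|c|).
  by apply: measurable_funM => //; exact: measurable_indic.
by move=> u _; rewrite normrM indicE normr_nat ler_piMl// lern1 leq_b1.
Qed.

Lemma indic_integrable (C : set R) (x y : R) : measurable C ->
  mu.-integrable `[x, y] (EFin \o (\1_C : R -> R)).
Proof.
move=> mC; apply: (@itv_bounded_integrable _ _ 1).
  exact: measurable_indic.
by move=> u _; rewrite indicE normr_nat lern1 leq_b1.
Qed.

Lemma transfer_integral t : \int[mu]_(u in `[0, t]) transfer A B u =
  fine (mu (B `&` `[0, t])) / fine (mu B) - fine (mu (A `&` `[0, t])) / fine (mu A).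
Proof.
rewrite RintegralB//; [|exact: indicM_integrable..].
by rewrite !RintegralZr ?Rintegral_indic//; exact: indic_integrable.
Qed.

Let fine_measureI_le t : fine (mu (B `&` `[0, t])) <= fine (mu B).
Proof.
have mBt : measurable (B `&` `[0, t]) by exact: measurableI.
have Boo : (mu B < +oo)%E by exact: itv_measure_lty BD.
have le_mu : (mu (B `&` `[0%R, t]) <= mu B)%E by apply: le_measure; rewrite ?inE.
by apply: fine_le; rewrite ?ge0_fin_numE// (le_lt_trans le_mu).
Qed.

(** Up to [t0] only the withdrawal from [A] counts, since [B] meets [[0, t]] at most in the point
    [t0]. After [t0] all of [A] has been withdrawn, and [B] has given back at most its unit mass. *)
Lemma transfer_le0 t t0 : A `<=` `[0, t0] -> B `<=` `[t0, D] ->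
  \int[mu]_(u in `[0, t]) transfer A B u <= 0.
Proof.
move=> At0 Bt0; rewrite transfer_integral subr_le0.
have [tt0|t0t] := leP t t0.
  rewrite [mu (B `&` _)](_ : _ = 0)%E ?mul0r ?divr_ge0 ?fine_ge0//.
  apply/eqP; rewrite eq_le measure_ge0 andbT.
  rewrite -(@lebesgue_measure_set1 R t0); apply: le_measure; rewrite ?inE//.
    exact: measurableI.
  move=> u [/Bt0/=]; rewrite !in_itv/= => /andP[t0u _] /andP[_ ut].
  by apply/eqP; rewrite eq_le t0u andbT (le_trans ut).
rewrite [A `&` _](_ : _ = A) ?divff ?gt_eqF//; last first.
  apply/setIidl => u /At0/=; rewrite !in_itv/= => /andP[-> ut0].
  by rewrite (le_trans ut0)// ltW.
by rewrite ler_pdivrMr// mul1r fine_measureI_le.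
Qed.

Lemma transfer_le1 t : \int[mu]_(u in `[0, t]) transfer A B u <= 1.
Proof.
rewrite transfer_integral lerBlDr ler_wpDr// ?divr_ge0 ?fine_ge0//.
by rewrite ler_pdivrMr// mul1r fine_measureI_le.
Qed.

(** Before [x] nothing has been moved, and after [y] both unit masses have been counted in full. An
    exchange inside [[x, y]] therefore leaves energy totals outside it unchanged. *)
Lemma transfer_eq0 t x y : A `<=` `[x, y] -> B `<=` `[x, y] ->
  t <= x \/ y <= t -> \int[mu]_(u in `[0, t]) transfer A B u = 0.
Proof.
move=> Axy Bxy [tx|yt]; rewrite transfer_integral.
  have null (C : set R) : measurable C -> C `<=` `[x, y] ->
      mu (C `&` `[0, t]) = 0%E.
    move=> mC Cxy; apply/eqP; rewrite eq_le measure_ge0 andbT.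
    rewrite -(@lebesgue_measure_set1 R x); apply: le_measure; rewrite ?inE//.
      exact: measurableI.
    move=> u [/Cxy/=]; rewrite !in_itv/= => /andP[xu _] /andP[_ ut].
    by apply/eqP; rewrite eq_le xu andbT (le_trans ut).
  by rewrite !null// !mul0r subrr.
have full (C : set R) : C `<=` `[0, D] -> C `<=` `[x, y] -> C `&` `[0, t] = C.
  move=> CD Cxy; apply/setIidl => u Cu; move: (CD _ Cu) (Cxy _ Cu).
  by rewrite /= !in_itv/= => /andP[-> _] /andP[_ uy]; rewrite (le_trans uy).
by rewrite !full// !divff ?gt_eqF// subrr.
Qed.

End transfer.

Lemma scale_integrable (A : set R) (k : R) (f : R -> R) : measurable A ->
  mu.-integrable A (EFin \o f) -> mu.-integrable A (EFin \o (fun u => k * f u)).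
Proof. by move=> mA intf; exact: (@integrableZl _ _ _ mu A mA k _ intf). Qed.

Lemma itv_bounded_mul_integrable (x y M : R) (f g : R -> R) :
  measurable_fun `[x, y] f -> (forall u, u \in `[x, y] -> `|f u| <= M) ->
  mu.-integrable `[x, y] (EFin \o g) ->
  mu.-integrable `[x, y] (EFin \o (fun u => f u * g u)).
Proof.
move=> mf fM intg; have mg : measurable_fun `[x, y] g.
  by apply/measurable_EFinP; exact: (measurable_int mu).
have intMg : mu.-integrable `[x, y] (EFin \o (fun u => M * g u)).
  exact: scale_integrable.
apply: (le_integrable _ _ _ intMg) => //.
  by apply/measurable_EFinP; exact: measurable_funM.
move=> u /= /fM fuM; rewrite lee_fin !normrM ler_wpM2r//.
by rewrite (le_trans fuM)// ler_norm.
Qed.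

(** Tangent bound for the concave function ln, taken at the new value [y]: the gain is then bounded
    exactly, without a second-order remainder. *)
Lemma ln_diff_ge (x y : R) : 0 < x -> 0 < y -> 1 - x / y <= ln y - ln x.
Proof.
move=> x0 y0; have xy0 : 0 < x / y by rewrite divr_gt0.
have /le_ln1Dx : -1 < x / y - 1 by rewrite ltrBrDr addNr.
by rewrite addrC subrK ln_div ?posrE//; lra.
Qed.

Lemma throughput_fin (D : R) (P : R -> R) : (forall u, u \in `[0, D] -> 0 <= P u) ->
  mu.-integrable `[0, D] (EFin \o P) ->
  throughput D P =
  (2^-1 / ln 2 * \int[mu]_(u in `[0, D]) ln (1 + P u))%:E.
Proof.
move=> P0 intP; have intL := ln1D_integrable (measurable_itv _) P0 intP.
rewrite -RintegralZl// /Rintegral fineK.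
  by apply: eq_integral => u _; congr EFin; ring.
apply: integrable_fin_num => //.
exact: scale_integrable.
Qed.

(** * Throughput gain of a weighted transfer *)

Section throughput_transfer.
Variables (D M q q' eps : R) (P w : R -> R) (A B : set R).
Hypotheses (mA : measurable A) (mB : measurable B).
Hypotheses (AD : A `<=` `[0, D]) (BD : B `<=` `[0, D]).
Hypotheses (A_gt0 : (0 < mu A)%E) (B_gt0 : (0 < mu B)%E).
Hypotheses (P_ge0 : forall u, u \in `[0, D] -> 0 <= P u)
  (intP : mu.-integrable `[0, D] (EFin \o P)).
Hypotheses (mw : measurable_fun `[0, D] w)
  (w_gt0 : forall u, u \in `[0, D] -> 0 < w u)
  (w_le : forall u, u \in `[0, D] -> w u <= M).
Hypotheses (q_gt0 : 0 < q) (eps_gt0 : 0 < eps)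
  (qq' : q + eps / fine (mu B) < q' - eps / fine (mu A)).
Hypotheses (PA : forall u, A u -> w u * q' <= 1 + P u)
  (PB : forall u, B u -> 1 + P u <= w u * q).

Let P' u := P u + eps * (w u * transfer A B u).

Let fA_gt0 : 0 < fine (mu A). Proof. exact: fine_measure_gt0 AD A_gt0. Qed.
Let fB_gt0 : 0 < fine (mu B). Proof. exact: fine_measure_gt0 BD B_gt0. Qed.
Let eA_gt0 : 0 < eps / fine (mu A). Proof. by rewrite divr_gt0. Qed.
Let eB_gt0 : 0 < eps / fine (mu B). Proof. by rewrite divr_gt0. Qed.

(** The ratio (1 + P) / w is at least [q'] on [A] and at most [q] on [B], and [qq'] separates these
    levels. *)
Lemma transfer_disjoint u : A u -> ~ B u.
Proof.
move=> Au Bu; have := le_trans (PA Au) (PB Bu).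
by rewrite ler_pM2l ?w_gt0 ?AD//; move: eA_gt0 eB_gt0 qq'; lra.
Qed.

Lemma transfer_inA u : A u -> transfer A B u = - (fine (mu A))^-1.
Proof.
move=> Au; rewrite /transfer !indicE (mem_set Au) (memNset (transfer_disjoint Au)).
by rewrite mul0r sub0r mul1r.
Qed.

Lemma transfer_inB u : B u -> transfer A B u = (fine (mu B))^-1.
Proof.
move=> Bu; have Au : ~ A u by move=> /transfer_disjoint.
by rewrite /transfer !indicE (mem_set Bu) (memNset Au) mul0r subr0 mul1r.
Qed.

Lemma transfer_notin u : ~ A u -> ~ B u -> transfer A B u = 0.
Proof. by move=> Au Bu; rewrite /transfer !indicE !memNset// !mul0r subrr. Qed.

(** Only [A] loses power. For [u] in [A] and any [v] in [B], the new 1 + P' at [u] is at least w u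
    (q' - eps / mu A) >= w v q >= 1 + P v >= 1; the middle inequality uses the order of the
    weights. *)
Lemma transferred_ge0 : (forall u v, A u -> B v -> w v <= w u) ->
  forall u, u \in `[0, D] -> 0 <= P' u.
Proof.
move=> wBA u uD; rewrite /P'; have [Au|Au] := pselect (A u); last first.
  have [Bu|Bu] := pselect (B u).
    rewrite transfer_inB// addr_ge0 ?P_ge0// !mulr_ge0 ?invr_ge0//; do ?exact: ltW.
    by rewrite ltW// w_gt0.
  by rewrite transfer_notin// !mulr0 addr0 P_ge0.
rewrite transfer_inA//.
have [v Bv] : B !=set0.
  by apply/set0P; apply: contraTneq B_gt0 => ->; rewrite measure0 ltxx.
have wq : 1 <= w v * q by apply: le_trans (PB Bv); rewrite lerDl P_ge0//; exact: BD.
have q'q : q <= q' - eps / fine (mu A) by move: eB_gt0 qq'; lra.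
have : 1 <= w u * (q' - eps / fine (mu A)).
  apply: (le_trans wq); apply: ler_pM (wBA _ _ Au Bv) q'q; last exact: ltW.
  by rewrite ltW// w_gt0//; exact: BD.
by have := PA Au; lra.
Qed.

Lemma weighted_transfer_integrable t : t <= D ->
  mu.-integrable `[0, t] (EFin \o (fun u => w u * transfer A B u)).
Proof.
move=> tD; have tDs : `[0, t] `<=` `[0, D].
  by move=> u /=; rewrite !in_itv/= => /andP[-> /le_trans]; exact.
apply: (@itv_bounded_mul_integrable _ _ M).
- exact: measurable_funS mw.
- by move=> u /tDs uD; rewrite gtr0_norm ?w_gt0// w_le.
- apply: itv_bounded_integrable; first exact: measurable_transfer.
  by move=> u _; exact: (transfer_bounded mA mB AD BD).
Qed.

Lemma transferred_integrable t : t <= D ->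
  mu.-integrable `[0, t] (EFin \o P').
Proof.
move=> tD; apply: add_integrable => //.
  by apply: integrableS intP => //; apply: subset_itvl; rewrite bnd_simp.
by apply: scale_integrable => //; exact: weighted_transfer_integrable.
Qed.

(** By [ln_diff_ge] the pointwise gain is at least eps * w * transfer / (1 + P'). Even after the
    move, (1 + P') / w is at least 1 / kA on [A] and at most 1 / kB on [B]. The weight cancels,
    which leaves the step function [g] as a lower bound, with integral eps * (kB - kA) > 0. *)
Lemma throughput_transfer : (forall u, u \in `[0, D] -> 0 <= P' u) ->
  (throughput D P < throughput D P')%E.
Proof.
move=> P'_ge0; rewrite !throughput_fin//; last exact: transferred_integrable.
rewrite lte_fin ltr_pM2l; last by rewrite divr_gt0 ?invr_gt0 ?ln_gt0 ?ltr1n.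
pose kA := (q' - eps / fine (mu A))^-1; pose kB := (q + eps / fine (mu B))^-1.
have kB_gt0 : 0 < (q + eps / fine (mu B)) by rewrite addr_gt0.
have kA_gt0 : 0 < (q' - eps / fine (mu A)) by exact: lt_trans qq'.
have kAB : kA < kB by rewrite ltf_pV2 ?posrE.
pose g u := \1_B u * (eps * kB / fine (mu B)) - \1_A u * (eps * kA / fine (mu A)).
have intg : mu.-integrable `[0, D] (EFin \o g).
  by apply: sub_integrable => //; exact: indicM_integrable.
have intgE : \int[mu]_(u in `[0, D]) g u = eps * (kB - kA).
  rewrite RintegralB//; [|exact: indicM_integrable..].
  rewrite !RintegralZr//; [|exact: indic_integrable..].
  rewrite !Rintegral_indic// !setIidl//.
  by move: fA_gt0 fB_gt0 => /lt0r_neq0 ? /lt0r_neq0 ?; field; apply/andP.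
have intL := ln1D_integrable (measurable_itv _) P_ge0 intP.
apply: (@lt_le_trans _ _ (\int[mu]_(u in `[0, D]) (ln (1 + P u) + g u))).
  by rewrite RintegralD// intgE ltrDl mulr_gt0// subr_gt0.
apply: le_Rintegral => //.
- exact: add_integrable.
- by apply: ln1D_integrable => //; exact: transferred_integrable.
move=> u uD; have P1 : 0 < 1 + P u by rewrite ltr_wpDr ?P_ge0.
have P'1 : 0 < 1 + P' u by rewrite ltr_wpDr ?P'_ge0.
have w0 := w_gt0 uD.
rewrite -lerBrDl; apply: le_trans (ln_diff_ge P1 P'1).
have -> : 1 - (1 + P u) / (1 + P' u) = eps * (w u * transfer A B u) / (1 + P' u).
  by rewrite /P'; field; rewrite gt_eqF// -/(P' u).
rewrite /g !indicE.
have [Au|Au] := pselect (A u).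
  rewrite (memNset (transfer_disjoint Au)) (mem_set Au) mul0r mul1r sub0r.
  rewrite transfer_inA// !mulrN mulNr lerN2 ler_pdivrMr//.
  have wP' : w u * (q' - eps / fine (mu A)) <= 1 + P' u.
    by rewrite /P' transfer_inA//; have := PA Au; lra.
  have k0 : 0 <= eps * kA / fine (mu A).
    by rewrite !mulr_ge0 ?invr_ge0//; exact: ltW.
  apply: le_trans (ler_wpM2l k0 wP').
  have -> : eps * kA / fine (mu A) * (w u * (q' - eps / fine (mu A))) =
      eps * (w u / fine (mu A)) * (kA * (q' - eps / fine (mu A))) by ring.
  by rewrite mulVf ?mulr1// gt_eqF.
have [Bu|Bu] := pselect (B u); last first.
  by rewrite transfer_notin// !memNset// !mul0r !mulr0 !mul0r subrr.
rewrite (memNset Au) (mem_set Bu) mul0r mul1r subr0.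
rewrite transfer_inB// ler_pdivlMr//.
have wP' : 1 + P' u <= w u * (q + eps / fine (mu B)).
  by rewrite /P' transfer_inB//; have := PB Bu; lra.
have k0 : 0 <= eps * kB / fine (mu B).
  by rewrite !mulr_ge0 ?invr_ge0//; exact: ltW.
apply: le_trans (ler_wpM2l k0 wP') _.
have -> : eps * kB / fine (mu B) * (w u * (q + eps / fine (mu B))) =
    eps * (w u / fine (mu B)) * (kB * (q + eps / fine (mu B))) by ring.
by rewrite mulVf ?mulr1// gt_eqF.
Qed.

End throughput_transfer.

End integrals.

(** * Optimality excludes feasible transfers *)

(** Chooses the amount of a transfer: below the feasibility margin [d], and too small to close a gap
    [c] between two levels. *)
Lemma small_pos (R : realFieldType) (c d k : R) : 0 < c -> 0 < d -> 0 < k ->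
  exists e : R, [/\ 0 < e, e < d & e * k < c].
Proof.
move=> c0 d0 k0; exists (Num.min (d / 2) (c / (2 * k))).
have ck : 0 < c / (2 * k) by rewrite divr_gt0// mulr_gt0.
split; first by rewrite lt_min ck andbT divr_gt0.
  by rewrite gt_min; apply/orP; left; lra.
apply: (@le_lt_trans _ _ (c / (2 * k) * k)).
  by rewrite ler_wpM2r ?ge_min ?lexx ?orbT// ltW.
have -> : c / (2 * k) * k = c / 2 by field; rewrite gt_eqF.
lra.
Qed.

Lemma arrival_le (R : numDomainType) (N : nat) (s : nat -> R) (i j : nat) :
  (forall k, (k <= N)%N -> s k < s k.+1) -> (i <= j)%N -> (j <= N.+1)%N -> s i <= s j.
Proof.
move=> s_incr; elim: j => [|j IHj]; first by rewrite leqn0 => /eqP ->.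
rewrite leq_eqVlt => /predU1P[-> //|ij jN].
by rewrite (le_trans (IHj ij (ltnW jN)))// ltW// s_incr.
Qed.

Lemma Rintegral_itv0_le (R : realType) (f : R -> R) (x y : R) : 0 <= x -> x <= y ->
  (forall u, u \in `[0, y] -> 0 <= f u) ->
  (@lebesgue_measure R).-integrable `[0, y] (EFin \o f) ->
  \int[lebesgue_measure]_(u in `[0, x]) f u <= \int[lebesgue_measure]_(u in `[0, y]) f u.
Proof.
move=> x0 xy f0 intf; rewrite -subr_ge0 Rintegral_itvB ?bnd_simp//.
apply: Rintegral_ge0 => u /=; rewrite in_itv/= => /andP[xu uy].
by rewrite f0// in_itv/= uy andbT (le_trans x0)// ltW.
Qed.

Section policy.
Context {R : realType}.
Local Notation mu := (@lebesgue_measure R).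
Variables (D a b Te Tc : R) (N : nat) (s E : nat -> R).
Hypotheses (D_gt0 : 0 < D) (a_gt0 : 0 < a) (b_gt0 : 0 < b).

Lemma subitv0 t : t <= D -> `[0, t] `<=` `[0, D].
Proof. by move=> tD; apply: subset_itvl; rewrite bnd_simp. Qed.

(** Causality at the deadline is an extended-real inequality with a finite right side, so it bounds
    the whole integral of [P]. *)
Lemma causal_integrable (P : R -> R) : power_policy D P ->
  energy_causal D N s E P -> mu.-integrable `[0, D] (EFin \o P).
Proof.
move=> [mP P0] cP; apply/integrableP; split; first exact/measurable_EFinP.
have DD : D \in `]0, D] by rewrite in_itv/= D_gt0 lexx.
apply: le_lt_trans (ltry (\sum_(i < (last_arrival N s D).+1) E i)).
apply: le_trans (cP _ DD); rewrite le_eqVlt; apply/orP; left; apply/eqP.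
apply: eq_integral => u; rewrite inE => uD /=.
by rewrite ger0_norm ?P0.
Qed.

Lemma causalP (P : R -> R) : mu.-integrable `[0, D] (EFin \o P) ->
  energy_causal D N s E P <-> forall t, t \in `]0, D] ->
    \int[mu]_(u in `[0, t]) P u <= \sum_(i < (last_arrival N s t).+1) E i.
Proof.
move=> intP; split=> cP t tD; have := cP t tD.
  have tD' : t <= D by move: tD; rewrite in_itv/= => /andP[].
  rewrite -lee_fin /Rintegral fineK//; apply: integrable_fin_num => //.
  by apply: integrableS intP => //; exact: subitv0.
have tD' : t <= D by move: tD; rewrite in_itv/= => /andP[].
rewrite -lee_fin /Rintegral fineK//; apply: integrable_fin_num => //.
by apply: integrableS intP => //; exact: subitv0.
Qed.

Lemma heat_integrable (P : R -> R) : mu.-integrable `[0, D] (EFin \o P) ->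
  mu.-integrable `[0, D] (EFin \o (fun u => a * expR (b * u) * P u)).
Proof.
move=> intP; apply: (@itv_bounded_mul_integrable _ _ _ (a * expR (b * D))) => //.
  by apply: measurable_funM => //; apply: measurableT_comp.
move=> u; rewrite in_itv/= => /andP[_ uD].
by rewrite ger0_norm ?mulr_ge0 ?expR_ge0 ?(ltW a_gt0)// ler_pM2l// ler_expR ler_pM2l.
Qed.

(** The integral of an integrable function depends continuously on its upper bound, so no regularity
    of [P] is involved. *)
Lemma temperature_continuous (P : R -> R) : mu.-integrable `[0, D] (EFin \o P) ->
  {within `[0, D], continuous (temperature a b Te P)}.
Proof.
move=> intP; have := parameterized_integral_continuous (ltW D_gt0) (heat_integrable intP).
rewrite /temperature /parameterized_integral => cint x.
apply: cvgD; first exact: cvg_cst.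
apply: cvgM; last exact: cint.
have cE : {within `[0, D], continuous (fun t : R => expR (- (b * t)))}.
  apply: continuous_subspaceT => t.
  apply: continuous_comp; last exact: continuous_expR.
  by apply: cvgN; apply: cvgMr; exact: cvg_id.
exact: cE.
Qed.

Section exchange.
Variable (P : R -> R).
Hypothesis P_opt : optimal_policy D a b Te Tc N s E P.

Lemma optimal_ge0 u : u \in `[0, D] -> 0 <= P u.
Proof. by case: P_opt => -[[_ P0] _ _] _; exact: P0. Qed.

Lemma optimal_integrable : mu.-integrable `[0, D] (EFin \o P).
Proof. by case: P_opt => -[pP _ cP] _; exact: causal_integrable. Qed.

Lemma optimal_causal t : t \in `]0, D] ->
  \int[mu]_(u in `[0, t]) P u <= \sum_(i < (last_arrival N s t).+1) E i.
Proof. by case: P_opt => -[_ _ cP] _; exact: (causalP optimal_integrable).1. Qed.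

Section no_transfer.
Variables (M q q' eps0 : R) (w : R -> R) (A B : set R).
Hypotheses (mA : measurable A) (mB : measurable B).
Hypotheses (AD : A `<=` `[0, D]) (BD : B `<=` `[0, D]).
Hypotheses (mw : measurable_fun `[0, D] w)
  (w_gt0 : forall u, u \in `[0, D] -> 0 < w u)
  (w_le : forall u, u \in `[0, D] -> w u <= M).
Hypotheses (qq' : q < q') (eps0_gt0 : 0 < eps0).
Hypotheses (PA : forall u, A u -> w u * q' <= 1 + P u)
  (PB : forall u, B u -> 1 + P u <= w u * q).
Hypothesis (wBA : forall u v, A u -> B v -> w v <= w u).

Hypothesis cold : forall eps, 0 < eps < eps0 -> forall t, t \in `[0, D] ->
  temperature a b Te P t + expR (- (b * t)) *
    (eps * \int[mu]_(u in `[0, t])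
      (a * expR (b * u) * (w u * transfer A B u))) <= Tc.

(** Nonnegativity and integrability of the new policy are granted as premises: when power is
    advanced, causality inside the interval follows from the consumed energy being nondecreasing in
    time. *)
Hypothesis causal : forall eps, 0 < eps < eps0 ->
  (forall u, u \in `[0, D] -> 0 <= P u + eps * (w u * transfer A B u)) ->
  mu.-integrable `[0, D] (EFin \o (fun u => P u + eps * (w u * transfer A B u))) ->
  forall t, t \in `]0, D] ->
  \int[mu]_(u in `[0, t]) (P u + eps * (w u * transfer A B u))
    <= \sum_(i < (last_arrival N s t).+1) E i.

(* Otherwise P + eps * w * transfer A B would be feasible and strictly better
   than P for small eps > 0. *)
Lemma no_transfer : mu A = 0%E \/ mu B = 0%E.
Proof.
have [->|A_neq0] := eqVneq (mu A) 0%E; first by left.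
have [->|B_neq0] := eqVneq (mu B) 0%E; first by right.
have A_gt0 : (0 < mu A)%E by rewrite lt0e A_neq0 measure_ge0.
have B_gt0 : (0 < mu B)%E by rewrite lt0e B_neq0 measure_ge0.
have fA_gt0 := fine_measure_gt0 mA AD A_gt0.
have fB_gt0 := fine_measure_gt0 mB BD B_gt0.
have q_gt0 : 0 < q.
  have [v Bv] : B !=set0 by apply/set0P; apply: contra_neq B_neq0 => ->; rewrite measure0.
  have := PB Bv; have := optimal_ge0 (BD Bv); have := w_gt0 (BD Bv) => w0 P0 Pq.
  by rewrite -(pmulr_rgt0 _ w0); lra.
(* With this [k], the bound [eps * k < q' - q] keeps the two levels apart after the transfer. *)
pose k := (fine (mu B))^-1 + (fine (mu A))^-1.
have [||eps [eps_gt0 eps_lt epsk]] := @small_pos _ (q' - q) eps0 k _ eps0_gt0.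
- by rewrite subr_gt0.
- by rewrite addr_gt0 ?invr_gt0.
have qq'eps : q + eps / fine (mu B) < q' - eps / fine (mu A).
  by move: epsk; rewrite /k; lra.
have epsP : 0 < eps < eps0 by rewrite eps_gt0.
have intP := optimal_integrable.
pose P' u := P u + eps * (w u * transfer A B u).
have P'_ge0 : forall u, u \in `[0, D] -> 0 <= P' u.
  exact: (transferred_ge0 mA mB AD BD A_gt0 B_gt0 optimal_ge0 w_gt0 q_gt0
    eps_gt0 qq'eps PA PB wBA).
have intP' : mu.-integrable `[0, D] (EFin \o P').
  exact: (transferred_integrable eps mA mB AD BD A_gt0 B_gt0 intP mw w_gt0 w_le).
have := throughput_transfer mA mB AD BD A_gt0 B_gt0 optimal_ge0 intP mw w_gt0 w_le
  q_gt0 eps_gt0 qq'eps PA PB P'_ge0.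
rewrite ltNge; case: P_opt => _ ->//; split.
- by split=> //; apply/measurable_EFinP; exact: (measurable_int mu).
- move=> t tD; apply: le_trans (cold epsP tD); rewrite le_eqVlt; apply/orP; left.
  apply/eqP; rewrite /temperature -addrA -mulrDr.
  have tD' : t <= D by move: tD; rewrite in_itv/= => /andP[].
  have intW := weighted_transfer_integrable mA mB AD BD A_gt0 B_gt0 mw w_gt0 w_le (lexx D).
  have int0t (f : R -> R) : mu.-integrable `[0, D] (EFin \o f) ->
      mu.-integrable `[0, t] (EFin \o (fun u => a * expR (b * u) * f u)).
    by move=> /heat_integrable; apply: integrableS => //; exact: subitv0.
  rewrite -[eps * _]RintegralZl//; last exact: int0t.
  rewrite -RintegralD//; [|exact: int0t|exact/scale_integrable/int0t].
  by congr (_ + _ * _); apply: eq_Rintegral => u _; rewrite /P'; ring.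
- by apply/causalP => //; exact: causal.
Qed.

End no_transfer.

(** * The two exchanges: delaying and advancing power *)

Lemma transfer_on_itv_integrable (A B : set R) t : measurable A -> measurable B ->
  A `<=` `[0, D] -> B `<=` `[0, D] -> mu.-integrable `[0, t] (EFin \o transfer A B).
Proof.
move=> mA mB AD BD; apply: sub_integrable => //; exact: indicM_integrable.
Qed.

(** The weight exp (- b u) cancels the factor exp (b u) of the heat integral, so the heat changes by
    [a * eps] times the integral of [transfer A B], which is never positive. For the energy, the
    weight is at least [w t0] on [A] and at most [w t0] on [B], so the same integral times [w t0]
    bounds the change. *)
Lemma delay_null (t0 q q' : R) (A B : set R) :
  measurable A -> measurable B -> t0 \in `[0, D] ->
  A `<=` `[0, t0] -> B `<=` `[t0, D] -> q < q' ->
  (forall u, A u -> q' <= expR (b * u) * (1 + P u)) ->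
  (forall u, B u -> expR (b * u) * (1 + P u) <= q) ->
  mu A = 0%E \/ mu B = 0%E.
Proof.
move=> mA mB; rewrite in_itv/= => /andP[t00 t0D] At0 Bt0 qq' PA PB.
have AD : A `<=` `[0, D].
  by move=> u /At0/=; rewrite !in_itv/= => /andP[-> /le_trans]; exact.
have BD : B `<=` `[0, D].
  by move=> u /Bt0/=; rewrite !in_itv/= => /andP[/(le_trans t00) -> ->].
have [->|A_neq0] := eqVneq (mu A) 0%E; first by left.
have [->|B_neq0] := eqVneq (mu B) 0%E; first by right.
have A_gt0 : (0 < mu A)%E by rewrite lt0e A_neq0 measure_ge0.
have B_gt0 : (0 < mu B)%E by rewrite lt0e B_neq0 measure_ge0.
pose w u := expR (- (b * u)).
have w_le0 (u v : R) : u <= v -> w v <= w u by rewrite ler_expR lerN2 ler_pM2l.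
have wE u : w u * expR (b * u) = 1 by rewrite /w expRN mulVf// gt_eqF ?expR_gt0.
have mw : measurable_fun `[0, D] w.
  by apply: measurableT_comp => //; apply: measurableT_comp => //; exact: measurable_funM.
have w_gt0 u : u \in `[0, D] -> 0 < w u by rewrite expR_gt0.
have w_le1 u : u \in `[0, D] -> w u <= w 0 by rewrite in_itv/= => /andP[/w_le0].
have int_le0 t := transfer_le0 mA mB AD BD A_gt0 B_gt0 t At0 Bt0.
have intT t := @transfer_on_itv_integrable A B t mA mB AD BD.
(* Delaying never violates a constraint, so the bound 1 on the amount is arbitrary. *)
apply: (@no_transfer (w 0) q q' 1 w A B) => //.
- by move=> u /PA; rewrite -(ler_pM2l (expR_gt0 (- (b * u)))) mulrA wE mul1r.
- by move=> u /PB; rewrite -(ler_pM2l (expR_gt0 (- (b * u)))) mulrA wE mul1r.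
- move=> u v /At0 + /Bt0; rewrite /= !in_itv/= => /andP[_ ut0] /andP[t0v _].
  exact/w_le0/(le_trans ut0).
- move=> eps /andP[eps_gt0 _] t tD.
  have : temperature a b Te P t <= Tc by case: P_opt => -[_ + _] _; exact.
  apply: le_trans; rewrite gerDl mulr_ge0_le0 ?expR_ge0// mulr_ge0_le0 ?(ltW eps_gt0)//.
  rewrite (_ : \int[mu]_(u in _) _ = a * \int[mu]_(u in `[0, t]) transfer A B u).
    by rewrite mulr_ge0_le0// ltW.
  rewrite -RintegralZl//; apply: eq_Rintegral => u _.
  by rewrite mulrA -(mulrA a) (mulrC (expR _)) wE mulr1.
- move=> eps /andP[eps_gt0 _] _ _ t tD.
  have tD' : t <= D by move: tD; rewrite in_itv/= => /andP[].
  apply: le_trans (optimal_causal tD).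
  have intP : mu.-integrable `[0, t] (EFin \o P).
    by apply: integrableS optimal_integrable => //; exact: subitv0.
  have intW : mu.-integrable `[0, t] (EFin \o (fun u => w u * transfer A B u)).
    by have := weighted_transfer_integrable mA mB AD BD A_gt0 B_gt0 mw w_gt0 w_le1 tD'.
  rewrite RintegralD ?RintegralZl//; last exact: scale_integrable.
  rewrite gerDl mulr_ge0_le0 ?(ltW eps_gt0)//.
  apply: (@le_trans _ _ (w t0 * \int[mu]_(u in `[0, t]) transfer A B u)); last first.
    by rewrite mulr_ge0_le0 ?expR_ge0.
  rewrite -RintegralZl//; apply: le_Rintegral => //; first exact: scale_integrable.
  move=> u _; rewrite /transfer !mulrBr lerB// !indicE.
    have [/set_mem/Bt0|_] := boolP (u \in B); last by rewrite !mul0r !mulr0.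
    rewrite /= in_itv/= => /andP[t0u _].
    by rewrite ler_wpM2r ?w_le0// mulr_ge0 ?invr_ge0 ?fine_ge0.
  have [/set_mem/At0|_] := boolP (u \in A); last by rewrite !mul0r !mulr0.
  rewrite /= in_itv/= => /andP[_ ut0].
  by rewrite ler_wpM2r ?w_le0// mulr_ge0 ?invr_ge0 ?fine_ge0.
Qed.

(** Moving power to an earlier time raises heat and consumed energy only strictly between [x] and
    [y]. The temperature has room there because its maximum over the compact interval is below [Tc].
    The energy has room because no arrival lies strictly inside: the bound at [t] is the bound at
    [y], where the total consumed is unchanged. *)
Lemma advance_null (k : nat) (x t0 y p p' : R) (A B : set R) :
  (forall j, (j <= N)%N -> s j < s j.+1) -> s N.+1 = D -> (k <= N)%N ->
  0 <= x -> s k <= x -> x < t0 -> t0 < y -> y <= s k.+1 -> y <= D ->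
  (forall t, t \in `[x, y] -> temperature a b Te P t < Tc) ->
  measurable A -> measurable B ->
  B `<=` `[x, t0] -> A `<=` `[t0, y] -> p < p' ->
  (forall u, A u -> p' <= P u) -> (forall u, B u -> P u <= p) ->
  mu A = 0%E \/ mu B = 0%E.
Proof.
move=> s_incr s_end kN x0 skx xt0 t0y ysk yD cold mA mB Bx Ay pp' PA PB.
have Axy : A `<=` `[x, y].
  by move=> u /Ay/=; rewrite !in_itv/= => /andP[/(le_trans (ltW xt0)) -> ->].
have Bxy : B `<=` `[x, y].
  by move=> u /Bx/=; rewrite !in_itv/= => /andP[-> ut0]; rewrite (le_trans ut0)// ltW.
have xyD : `[x, y] `<=` `[0, D].
  move=> u /=; rewrite !in_itv/= => /andP[/(le_trans x0) -> /=].
  by move=> /le_trans; apply.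
have AD := subset_trans Axy xyD; have BD := subset_trans Bxy xyD.
have [->|A_neq0] := eqVneq (mu A) 0%E; first by left.
have [->|B_neq0] := eqVneq (mu B) 0%E; first by right.
have A_gt0 : (0 < mu A)%E by rewrite lt0e A_neq0 measure_ge0.
have B_gt0 : (0 < mu B)%E by rewrite lt0e B_neq0 measure_ge0.
have intT t := @transfer_on_itv_integrable A B t mA mB AD BD.
have m_le1 t : \int[mu]_(u in `[0, t]) transfer A B u <= 1.
  exact: transfer_le1 BD _ _.
have m_eq0 t : t <= x \/ y <= t -> \int[mu]_(u in `[0, t]) transfer A B u = 0.
  exact: transfer_eq0 AD BD _ _ _ _ _ Axy Bxy.
have [c cxy cmax] : exists2 c, c \in `[x, y] & forall t, t \in `[x, y] ->
    temperature a b Te P t <= temperature a b Te P c.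
  apply: EVT_max; first exact/ltW/(lt_trans xt0).
  exact: continuous_subspaceW xyD (temperature_continuous optimal_integrable).
pose K := a * expR (b * t0).
have K_gt0 : 0 < K by rewrite mulr_gt0// expR_gt0.
(* The margin at the hottest instant [c], divided by a bound [K] on the extra heat per unit moved:
   exp (b u) is at most exp (b t0) on [B] and at least that on [A]. *)
pose eps0 := (Tc - temperature a b Te P c) / K.
have eps0_gt0 : 0 < eps0 by rewrite divr_gt0// subr_gt0 cold.
apply: (@no_transfer 1 (1 + p) (1 + p') eps0 (fun=> 1) A B) => //.
- by rewrite ltrD2l.
- by move=> u /PA; rewrite mul1r lerD2l.
- by move=> u /PB; rewrite mul1r lerD2l.
- move=> eps /andP[eps_gt0 eps_lt] t tD.
  have Pcold : temperature a b Te P t <= Tc by case: P_opt => -[_ + _] _; exact.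
  have heat_le : \int[mu]_(u in `[0, t]) (a * expR (b * u) * (1 * transfer A B u)) <=
      K * \int[mu]_(u in `[0, t]) transfer A B u.
    have tD' : t <= D by move: tD; rewrite in_itv/= => /andP[].
    have intH := heat_integrable (intT D).
    rewrite -RintegralZl//; apply: le_Rintegral => //.
    - under [X in EFin \o X]eq_fun do rewrite mul1r.
      by apply: integrableS intH => //; exact: subitv0.
    - exact: scale_integrable.
    move=> u _; rewrite mul1r /transfer !mulrBr lerB// !indicE.
      have [/set_mem/Bx|_] := boolP (u \in B); last by rewrite !mul0r !mulr0.
      rewrite /= in_itv/= => /andP[_ ut0]; rewrite ler_wpM2r//.
        by rewrite mulr_ge0 ?invr_ge0 ?fine_ge0.
      by rewrite ler_pM2l// ler_expR ler_pM2l.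
    have [/set_mem/Ay|_] := boolP (u \in A); last by rewrite !mul0r !mulr0.
    rewrite /= in_itv/= => /andP[t0u _]; rewrite ler_wpM2r//.
      by rewrite mulr_ge0 ?invr_ge0 ?fine_ge0.
    by rewrite ler_pM2l// ler_expR ler_pM2l.
  have [txy|txy] : t \in `[x, y] \/ (t <= x \/ y <= t).
    have [tx|xt] := leP t x; first by right; left.
    have [yt|ty] := leP y t; first by right; right.
    by left; rewrite in_itv/= !ltW.
  + apply: (@le_trans _ _ (temperature a b Te P c + eps * K)); last first.
      by move: eps_lt; rewrite ltr_pdivlMr//; lra.
    rewrite lerD ?cmax//.
    have heatK : eps * \int[mu]_(u in `[0, t])
        (a * expR (b * u) * (1 * transfer A B u)) <= eps * K.
      by rewrite ler_pM2l// (le_trans heat_le)// ler_piMr ?(ltW K_gt0).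
    apply: (le_trans (ler_wpM2l (expR_ge0 _) heatK)).
    have t_ge0 : 0 <= t by move: tD; rewrite in_itv/= => /andP[].
    have e_le1 : expR (- (b * t)) <= 1 by rewrite -expR0 ler_expR oppr_le0 mulr_ge0// ltW.
    by rewrite ler_piMl// ltW// mulr_gt0.
  + apply: le_trans Pcold; rewrite gerDl mulr_ge0_le0 ?expR_ge0//.
    by rewrite mulr_ge0_le0 ?(ltW eps_gt0)// (le_trans heat_le)// m_eq0// mulr0.
- move=> eps /andP[eps_gt0 _] P'_ge0 intP' t tD.
  have shift z : z \in `]0, D] -> \int[mu]_(u in `[0, z]) (P u + eps * (1 * transfer A B u))
      = \int[mu]_(u in `[0, z]) P u + eps * \int[mu]_(u in `[0, z]) transfer A B u.
    rewrite in_itv/= => /andP[_ zD].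
    have intP : mu.-integrable `[0, z] (EFin \o P).
      by apply: integrableS optimal_integrable => //; exact: subitv0.
    rewrite -[eps * \int[mu]_(u in _) _]RintegralZl// -RintegralD//.
      by apply: eq_Rintegral => u _; rewrite mul1r.
    exact: scale_integrable.
  have [txy|[xt ty]] : (t <= x \/ y <= t) \/ (x < t /\ t < y).
    have [tx|xt] := leP t x; first by left; left.
    have [yt|ty] := leP y t; first by left; right.
    by right.
    by rewrite shift// m_eq0// mulr0 addr0 optimal_causal.
  have yD' : y \in `]0, D] by rewrite in_itv/= yD (le_lt_trans x0)// (lt_trans xt0).
  (* Arrivals up to [k] are at or before [x], later ones at or after [y]. Since [last_arrival]
     compares strictly, [t] and [y] see the same arrivals even when [y] is one itself. *)
  have -> : last_arrival N s t = last_arrival N s y.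
    apply: eq_bigl => j.
    have [jk|kj] := leqP j k.
      have sjx : s j <= x by apply: le_trans skx; apply: (arrival_le s_incr jk); exact: leqW.
      by rewrite !(le_lt_trans sjx)// (lt_trans xt0).
    have ysj : y <= s j by apply: (le_trans ysk); apply: (arrival_le s_incr kj); exact/ltnW/ltn_ord.
    by rewrite !ltNge ysj (ltW (lt_le_trans ty ysj)).
  apply: le_trans (optimal_causal yD').
  have -> : \int[mu]_(u in `[0, y]) P u =
      \int[mu]_(u in `[0, y]) (P u + eps * (1 * transfer A B u)).
    by rewrite shift// m_eq0 ?mulr0 ?addr0//; right.
  apply: Rintegral_itv0_le; rewrite ?(ltW ty)//; first by apply: ltW; apply: le_lt_trans xt.
  - by move=> u uy; apply: P'_ge0; exact: subitv0 uy.
  - by apply: integrableS intP' => //; exact: subitv0.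
Qed.

End exchange.

End policy.

(** * Essential monotonicity and heat balance *)

Lemma ae_forall_countable d (T : measurableType d) (R : realType)
    (nu : {measure set T -> \bar R}) (I : countType) (G : I -> T -> Prop) :
  (forall i, {ae nu, forall u, G i u}) -> {ae nu, forall u, forall i, G i u}.
Proof.
move=> aeG; have /ae_foralln : forall n, \forall u \ae nu,
    if unpickle n is Some i then G i u else True.
  by move=> n; case: unpickle => [i|]; [exact: aeG|exact: aeW].
by apply: filterS => u Gu i; have := Gu (pickle i); rewrite pickleK.
Qed.

Lemma ae_neq (R : realType) (z : R) : {ae @lebesgue_measure R, forall u, u <> z}.
Proof.
exists [set z]; split; [exact: measurable_set1|exact: lebesgue_measure_set1|].
by move=> u /= /contrapT.
Qed.

(** The endpoints are null, so a comparison on the open interval is enough; bounds on [P] to one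
    side of an instant come in that form. *)
Lemma ae_le_Rintegral (R : realType) (f g : R -> R) (x y : R) :
  (@lebesgue_measure R).-integrable `[x, y] (EFin \o f) ->
  (@lebesgue_measure R).-integrable `[x, y] (EFin \o g) ->
  (forall u, u \in `[x, y] -> 0 <= f u) -> (forall u, u \in `[x, y] -> 0 <= g u) ->
  {ae @lebesgue_measure R, forall u, u \in `]x, y[ -> f u <= g u} ->
  \int[lebesgue_measure]_(u in `[x, y]) f u <= \int[lebesgue_measure]_(u in `[x, y]) g u.
Proof.
move=> intf intg f0 g0 aefg; rewrite /Rintegral fine_le ?integrable_fin_num//.
apply: ae_ge0_le_integral => //.
- exact: (measurable_int lebesgue_measure).
- exact: (measurable_int lebesgue_measure).
have Fae := ae_filter_ringOfSetsType (@lebesgue_measure R).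
have aexy : {ae @lebesgue_measure R, forall u, u <> x /\ u <> y}.
  by apply: filterS2 (ae_neq x) (ae_neq y) => u; split.
apply: filterS2 aexy aefg => u [ux uy] fgu; rewrite /= in_itv/= => /andP[xu yu].
rewrite lee_fin; apply: fgu; rewrite in_itv/= !lt_neqAle xu yu !andbT.
by apply/andP; split; [rewrite eq_sym|]; exact/eqP.
Qed.

Section optimal.
Context {R : realType}.
Local Notation mu := (@lebesgue_measure R).
Variables (D a b Te Tc : R) (N : nat) (s E : nat -> R) (P : R -> R).
Hypotheses (D_gt0 : 0 < D) (a_gt0 : 0 < a) (b_gt0 : 0 < b).
Hypothesis P_opt : optimal_policy D a b Te Tc N s E P.

Let F u := expR (b * u) * (1 + P u).

Lemma measurable_weighted : measurable_fun `[0, D] F.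
Proof.
have mP : measurable_fun `[0, D] P by case: P_opt => -[[]].
apply: measurable_funM; last exact: measurable_funD.
by apply: measurableT_comp.
Qed.

(** By [delay_null], for every rational time and rational levels q < q' one of the two level sets is
    null. Discarding these countably many null sets leaves [Y]. If [F] decreased between two points
    of [Y], rationals separating the times and the values would place both points in level sets of
    which one was discarded. *)
Lemma ae_monotone : exists Y : set R, [/\ {ae mu, forall u, u \in `]0, D[ -> Y u},
  Y `<=` `]0, D[ & forall u v, Y u -> Y v -> u < v -> F u <= F v].
Proof.
(* A triple [c] holds the time [c.1.1], the lower level [c.1.2] and the upper level [c.2]. *)
pose A (c : rat * rat * rat) := `[0, ratr c.1.1] `&` (`[0, D] `&` F @^-1` `[ratr c.2, +oo[).
pose B (c : rat * rat * rat) := `[ratr c.1.1, D] `&` (`[0, D] `&` F @^-1` `]-oo, ratr c.1.2]).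
have mA c : measurable (A c).
  by apply: measurableI => //; exact: measurable_weighted.
have mB c : measurable (B c).
  by apply: measurableI => //; exact: measurable_weighted.
pose good (c : rat * rat * rat) u :=
  (mu (A c) = 0%E -> ~ A c u) /\ (mu (B c) = 0%E -> ~ B c u).
exists [set u | (u \in `]0, D[) /\ forall c, good c u]; split; last first.
- move=> u v [uD gu] [vD gv] uv; rewrite leNgt; apply/negP => Fvu.
  have [t tuv] := rat_in_itvoo uv.
  have [q' q'uv] := rat_in_itvoo Fvu.
  have [|q quv] := @rat_in_itvoo _ (F v) (ratr q').
    by move: q'uv; rewrite in_itv/= => /andP[].
  move: tuv q'uv quv uD vD; rewrite !in_itv/= => /andP[ut tv] /andP[vq' q'u] /andP[vq qq'].
  move=> /andP[u0 uD] /andP[v0 vD].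
  have Au : A (t, q, q') u.
    by rewrite /A /= !in_itv/= !andbT !ltW.
  have Bv : B (t, q, q') v.
    by rewrite /B /= !in_itv/= !ltW.
  have [||||||A0|B0] := @delay_null _ D a b Te Tc N s E D_gt0 a_gt0 b_gt0 P P_opt
    (ratr t) (ratr q) (ratr q') (A (t, q, q')) (B (t, q, q')) (mA _) (mB _).
  - by rewrite in_itv/= (ltW (lt_trans u0 ut)) (ltW (lt_trans tv vD)).
  - by move=> z [].
  - by move=> z [].
  - by [].
  - by move=> z [_ [_ /=]]; rewrite in_itv/= andbT.
  - by move=> z [_ [_ /=]]; rewrite in_itv/=.
  - by case: (gu (t, q, q')) => /(_ A0).
  - by case: (gv (t, q, q')) => _ /(_ B0).
- by move=> u [].
have Fae := ae_filter_ringOfSetsType mu.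
have aegood : {ae mu, forall u, forall c, good c u}.
  apply: ae_forall_countable => c.
  have aeN (C : set R) : measurable C -> {ae mu, forall u, mu C = 0%E -> ~ C u}.
    move=> mC; have [C0|C0] := eqVneq (mu C) 0%E; last first.
      by apply: aeW => u C0'; rewrite C0' eqxx in C0.
    by exists C; split => // u /=; apply: contra_notP => Cu _ /Cu.
  have hA := aeN _ (mA c); have hB := aeN _ (mB c).
  by apply: filterS2 hA hB => u; split.
by apply: filterS aegood => u gu uD.
Qed.

Let theta t := \int[mu]_(u in `[0, t]) (a * expR (b * u) * P u).

Lemma temperature_le t : (temperature a b Te P t <= Tc) =
  (theta t <= (Tc - Te) * expR (b * t)).
Proof.
rewrite /temperature -/(theta t) expRN -lerBrDl mulrC ler_pdivrMr ?expR_gt0//.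
Qed.

Lemma temperature_lt t : (temperature a b Te P t < Tc) =
  (theta t < (Tc - Te) * expR (b * t)).
Proof.
rewrite /temperature -/(theta t) expRN -ltrBrDl mulrC ltr_pdivrMr ?expR_gt0//.
Qed.

Lemma heatB x y : 0 <= x -> x < y -> y <= D ->
  theta y - theta x = \int[mu]_(u in `[x, y]) (a * expR (b * u) * P u).
Proof.
move=> x0 xy yD; have intH := heat_integrable a_gt0 b_gt0
  (optimal_integrable D_gt0 P_opt).
have intH0 : mu.-integrable `[0, y] (EFin \o (fun u => a * expR (b * u) * P u)).
  by apply: integrableS intH => //; exact: subitv0.
rewrite /theta Rintegral_itvB//; last by rewrite bnd_simp ltW.
rewrite Rintegral_itv_obnd_cbnd//.
by apply: integrableS intH0 => //; apply: subset_itvr; rewrite bnd_simp.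
Qed.

Lemma heat_expR (c x y : R) : x < y ->
  \int[mu]_(u in `[x, y]) (a * expR (b * u) * c) =
  a * c / b * (expR (b * y) - expR (b * x)).
Proof.
move=> xy; pose G u := a * c / b * expR (b * u).
have dG (u : R) : is_derive u 1 G (a * expR (b * u) * c).
  by apply: is_derive_eq; rewrite /GRing.scale/=; field; rewrite gt_eqF.
rewrite /Rintegral (@continuous_FTC2 _ _ G)//.
- by rewrite /G/= mulrBr.
- apply: continuous_subspaceT => u.
  apply/differentiable_continuous/derivable1_diffP.
  exact: ex_derive.
- have cG : continuous G.
    move=> u; apply/differentiable_continuous/derivable1_diffP.
    by case: (dG u).
  split; first by move=> u _; case: (dG u).
    exact/cvg_at_right_filter/cG.
  exact/cvg_at_left_filter/cG.
- by move=> u _; rewrite derive1E; exact: derive_val.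
Qed.

Hypothesis Te_lt_Tc : Te < Tc.

Lemma optimal_le_Tc t : t \in `[0, D] -> temperature a b Te P t <= Tc.
Proof. by case: P_opt => -[_ + _] _; exact. Qed.

Let itv_sub x y : 0 <= x -> y <= D -> `[x, y] `<=` `[0, D].
Proof.
move=> x0 yD u /=; rewrite !in_itv/= => /andP[/(le_trans x0) -> /=].
by move=> /le_trans; apply.
Qed.

Let heat_cst_integrable c x y : 0 <= x -> y <= D ->
  mu.-integrable `[x, y] (EFin \o (fun u => a * expR (b * u) * c)).
Proof.
move=> x0 yD; have := @heat_integrable _ D a b a_gt0 b_gt0 (fun=> c).
move=> intH; apply: integrableS (intH _) => //; first exact: itv_sub.
by apply: (@itv_bounded_integrable _ _ _ `|c|).
Qed.

Let heat_P_integrable x y : 0 <= x -> y <= D ->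
  mu.-integrable `[x, y] (EFin \o (fun u => a * expR (b * u) * P u)).
Proof.
move=> x0 yD; have intH := heat_integrable a_gt0 b_gt0 (optimal_integrable D_gt0 P_opt).
by apply: integrableS intH => //; exact: itv_sub.
Qed.

(* If P exceeds the equilibrium power b (Tc - Te) / a just after t, then T rises
   just after t, hence was below Tc. *)
Lemma heating_lt_Tc (t y p : R) : 0 <= t -> t < y -> y <= D ->
  b * (Tc - Te) / a < p ->
  {ae mu, forall u, u \in `]t, y[ -> p <= P u} -> temperature a b Te P t < Tc.
Proof.
move=> t0 ty yD kp aeP; rewrite temperature_lt.
have p0 : 0 < p by apply: lt_trans kp; rewrite divr_gt0// mulr_gt0// subr_gt0.
have le_heat : a * p / b * (expR (b * y) - expR (b * t)) <= theta y - theta t.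
  rewrite heatB// -heat_expR//; apply: ae_le_Rintegral.
  - exact: heat_cst_integrable.
  - exact: heat_P_integrable.
  - by move=> u _; rewrite !mulr_ge0 ?expR_ge0 ?(ltW a_gt0) ?(ltW p0).
  - move=> u /(itv_sub t0 yD) uD.
    by rewrite !mulr_ge0 ?expR_ge0 ?(ltW a_gt0)// (optimal_ge0 P_opt).
  have Fae := ae_filter_ringOfSetsType mu.
  by apply: filterS aeP => u + uI => /(_ uI) pP; rewrite ler_pM2l// mulr_gt0 ?expR_gt0.
have : theta y <= (Tc - Te) * expR (b * y).
  by rewrite -temperature_le optimal_le_Tc// in_itv/= yD (le_trans t0)// ltW.
have ety : expR (b * t) < expR (b * y) by rewrite ltr_expR ltr_pM2l.
have kp' : Tc - Te < a * p / b.
  by move: kp; rewrite ltr_pdivrMr// ltr_pdivlMr//; lra.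
have := ltr_pM2r (_ : 0 < expR (b * y) - expR (b * t)) (Tc - Te) (a * p / b).
rewrite kp' subr_gt0 => /(_ ety).
by rewrite mulrBr; lra.
Qed.

(** Mirror image of [heating_lt_Tc]: [theta] starts at [x] within the allowance (Tc - Te) exp (b x),
    and with power below equilibrium it grows strictly less than the allowance does up to [t]. *)
Lemma cooling_lt_Tc (x t p : R) : 0 <= x -> x < t -> t <= D ->
  0 <= p -> p < b * (Tc - Te) / a ->
  {ae mu, forall u, u \in `]x, t[ -> P u <= p} -> temperature a b Te P t < Tc.
Proof.
move=> x0 xt tD p0 kp aeP; rewrite temperature_lt.
have le_heat : theta t - theta x <= a * p / b * (expR (b * t) - expR (b * x)).
  rewrite heatB// -heat_expR//; apply: ae_le_Rintegral.
  - exact: heat_P_integrable.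
  - exact: heat_cst_integrable.
  - move=> u /(itv_sub x0 tD) uD.
    by rewrite !mulr_ge0 ?expR_ge0 ?(ltW a_gt0)// (optimal_ge0 P_opt).
  - by move=> u _; rewrite !mulr_ge0 ?expR_ge0 ?(ltW a_gt0).
  have Fae := ae_filter_ringOfSetsType mu.
  by apply: filterS aeP => u + uI => /(_ uI) pP; rewrite ler_pM2l// mulr_gt0 ?expR_gt0.
have : theta x <= (Tc - Te) * expR (b * x).
  by rewrite -temperature_le optimal_le_Tc// in_itv/= x0 (le_trans _ tD)// ltW.
have ext : expR (b * x) < expR (b * t) by rewrite ltr_expR ltr_pM2l.
have kp' : a * p / b < Tc - Te.
  by move: kp; rewrite ltr_pdivlMr// ltr_pdivrMr//; lra.
have := ltr_pM2r (_ : 0 < expR (b * t) - expR (b * x)) (a * p / b) (Tc - Te).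
rewrite kp' subr_gt0 => /(_ ext).
by rewrite mulrBr; lra.
Qed.

End optimal.

(** * Upward jumps between arrivals and boundedness *)

Lemma ae_itv_exists (R : realType) (G : R -> Prop) (x y : R) : x < y ->
  {ae @lebesgue_measure R, forall u, G u} -> exists2 u, u \in `]x, y[ & G u.
Proof.
move=> xy [C [mC C0 subC]]; apply: contrapT => noG.
have xyC : `]x, y[ `<=` C.
  by move=> u uxy; apply: subC => /= Gu; apply: noG; exists u.
have : (lebesgue_measure `]x, y[ <= lebesgue_measure C)%E.
  by apply: le_measure; rewrite ?inE.
rewrite C0 lebesgue_measure_itv/= lte_fin xy -EFinD lee_fin subr_le0.
by rewrite leNgt xy.
Qed.

Section jumps.
Context {R : realType}.
Local Notation mu := (@lebesgue_measure R).
Variables (D a b Te Tc : R) (N : nat) (s E : nat -> R) (P : R -> R).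
Hypotheses (D_gt0 : 0 < D) (a_gt0 : 0 < a) (b_gt0 : 0 < b) (Te_lt_Tc : Te < Tc).
Hypotheses (s_0 : s 0%N = 0) (s_incr : forall k, (k <= N)%N -> s k < s k.+1)
  (s_end : s N.+1 = D).
Hypothesis P_opt : optimal_policy D a b Te Tc N s E P.

Let F u := expR (b * u) * (1 + P u).

Lemma arrival_ge0 k : (k <= N.+1)%N -> 0 <= s k.
Proof. by move=> kN; rewrite -s_0 (arrival_le s_incr). Qed.

Lemma arrival_le_end k : (k <= N.+1)%N -> s k <= D.
Proof. by move=> kN; rewrite -s_end (arrival_le s_incr). Qed.

(** Almost everywhere bounds on two intervals make both level sets non-null, against [advance_null].
    The receiving interval may end at [z] before the giving one starts at [t0]. *)
Lemma advance_absurd (k : nat) (x z t0 y p p' : R) : (k <= N)%N ->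
  s k <= x -> x < z -> z <= t0 -> t0 < y -> y <= s k.+1 ->
  (forall t, t \in `[x, y] -> temperature a b Te P t < Tc) -> p < p' ->
  {ae mu, forall u, u \in `]x, z[ -> P u <= p} ->
  {ae mu, forall u, u \in `]t0, y[ -> p' <= P u} -> False.
Proof.
move=> kN skx xz zt0 t0y ysk cold pp' aeB aeA.
have Fae := ae_filter_ringOfSetsType mu.
have x0 : 0 <= x by rewrite (le_trans _ skx)// arrival_ge0// leqW.
have yD : y <= D by rewrite (le_trans ysk)// arrival_le_end.
(* The intersection with [[0, D]] is there because [P] is measurable only on that interval. *)
pose B := `[x, z] `&` (`[0, D] `&` P @^-1` `]-oo, p]).
pose A := `[t0, y] `&` (`[0, D] `&` P @^-1` `[p', +oo[).
have mP : measurable_fun `[0, D] P by case: P_opt => -[[]].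
have mB : measurable B by apply: measurableI => //; exact: mP.
have mA : measurable A by apply: measurableI => //; exact: mP.
have not0 (C : set R) (x' y' : R) : measurable C -> x' < y' ->
    {ae mu, forall u, u \in `]x', y'[ -> C u} -> mu C = 0%E -> False.
  move=> mC xy' aeC C0.
  have aeNC : {ae mu, forall u, ~ C u} by exists C; split => // u /contrapT.
  have aeF : {ae mu, forall u, (u \in `]x', y'[ -> C u) /\ ~ C u}.
    by apply: filterS2 aeC aeNC => u; split.
  have [u uxy [Cu NCu]] := ae_itv_exists xy' aeF.
  exact: NCu (Cu uxy).
have Bx : B `<=` `[x, t0].
  by move=> u [+ _]; rewrite /= !in_itv/= => /andP[-> /le_trans]; exact.
have At : A `<=` `[t0, y] by move=> u [].
have PA u : A u -> p' <= P u by move=> [_ [_ /=]]; rewrite in_itv/= andbT.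
have PB u : B u -> P u <= p by move=> [_ [_ /=]]; rewrite in_itv/=.
have [A0|B0] := advance_null D_gt0 a_gt0 b_gt0 P_opt s_incr s_end kN x0 skx
  (lt_le_trans xz zt0) t0y ysk yD cold mA mB Bx At pp' PA PB.
- apply: (not0 A t0 y) => //; apply: filterS aeA => u uA uty.
  move: (uA uty); move: uty; rewrite /A/= !in_itv/= => /andP[tu uy] ->.
  by do ![split]; apply/andP; split=> //; lra.
- apply: (not0 B x z) => //; apply: filterS aeB => u uB uxz.
  move: (uB uxz); move: uxz; rewrite /B/= !in_itv/= => /andP[xu uz] ->.
  by do ![split]; apply/andP; split=> //; lra.
Qed.

Lemma no_jump (k : nat) (t0 x y p p' : R) : (k <= N)%N ->
  s k < t0 -> t0 < s k.+1 -> x < t0 -> t0 < y -> p < p' ->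
  {ae mu, forall u, u \in `]x, t0[ -> P u <= p} ->
  {ae mu, forall u, u \in `]t0, y[ -> p' <= P u} -> False.
Proof.
move=> kN skt tsk xt ty pp' aeB aeA.
have Fae := ae_filter_ringOfSetsType mu.
have t0_gt0 : 0 < t0 by rewrite (le_lt_trans _ skt)// arrival_ge0// leqW.
have t0_ltD : t0 < D by rewrite (lt_le_trans tsk)// arrival_le_end.
(* Both sides are clipped to the inter-arrival interval around [t0]. *)
pose x1 := Num.max x (s k); pose y1 := Num.min y (s k.+1).
have x1t : x1 < t0 by rewrite gt_max xt skt.
have ty1 : t0 < y1 by rewrite lt_min ty tsk.
have skx1 : s k <= x1 by rewrite le_max lexx orbT.
have y1sk : y1 <= s k.+1 by rewrite ge_min lexx orbT.
have x1_ge0 : 0 <= x1 by rewrite (le_trans _ skx1)// arrival_ge0// leqW.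
have y1D : y1 <= D by rewrite (le_trans y1sk)// arrival_le_end.
have aeB1 x' : x1 <= x' -> {ae mu, forall u, u \in `]x', t0[ -> P u <= p}.
  move=> xx'; apply: filterS aeB => u uP uI; apply: uP; move: uI.
  rewrite !in_itv/= => /andP[x'u ->]; rewrite andbT (le_lt_trans _ x'u)//.
  by rewrite (le_trans _ xx')// le_max lexx.
have aeA1 y' : y' <= y1 -> {ae mu, forall u, u \in `]t0, y'[ -> p' <= P u}.
  move=> yy'; apply: filterS aeA => u uP uI; apply: uP; move: uI.
  rewrite !in_itv/= => /andP[-> uy']/=; rewrite (lt_le_trans uy')//.
  by rewrite (le_trans yy')// ge_min lexx.
have p_ge0 : 0 <= p.
  have [u uI /(_ uI)] := ae_itv_exists x1t (aeB1 _ (lexx _)).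
  apply: le_trans; apply: (optimal_ge0 P_opt); move: uI; rewrite !in_itv/=.
  by move=> /andP[/ltW/(le_trans x1_ge0) -> /ltW/le_trans -> //]; rewrite ltW.
have Tt0 : temperature a b Te P t0 < Tc.
  (* Either [p] is below the equilibrium power and T stays below [Tc] from the left, or [p'] is
     above it and T is about to rise. *)
  have [pk|kp] := ltP p (b * (Tc - Te) / a).
    exact: (cooling_lt_Tc D_gt0 a_gt0 b_gt0 P_opt x1_ge0 x1t (ltW t0_ltD) p_ge0 pk
      (aeB1 _ (lexx _))).
  exact: (heating_lt_Tc D_gt0 a_gt0 b_gt0 P_opt Te_lt_Tc (ltW t0_gt0) ty1 y1D
    (le_lt_trans kp pp') (aeA1 _ (lexx _))).
have [x' [y' [x1x' x't ty' y'y1 cold]]] : exists x' y', [/\ x1 <= x', x' < t0, t0 < y',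
    y' <= y1 & forall t, t \in `[x', y'] -> temperature a b Te P t < Tc].
  have /(continuous_within_itvP _ D_gt0)[Tcont _ _] :
      {within `[0, D], continuous (temperature a b Te P)}.
    exact/temperature_continuous/(optimal_integrable D_gt0 P_opt).
  have /Tcont/cvgr_lt/(_ _ Tt0) : t0 \in `]0, D[ by rewrite in_itv/= t0_gt0.
  move=> [e /= e0 near_cold].
  exists (Num.max x1 (t0 - e / 2)), (Num.min y1 (t0 + e / 2)); split.
  - by rewrite le_max lexx.
  - by rewrite gt_max x1t/=; lra.
  - by rewrite lt_min ty1/=; lra.
  - by rewrite ge_min lexx.
  move=> t; rewrite in_itv/= ge_max le_min => /andP[/andP[_ tl] /andP[_ tu]].
  by apply: near_cold => /=; rewrite ltr_norml; apply/andP; split; lra.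
exact: (@advance_absurd k x' t0 t0 y' p p' kN (le_trans skx1 x1x') x't (lexx _) ty'
  (le_trans y'y1 y1sk) cold pp' (aeB1 _ x1x') (aeA1 _ y'y1)).
Qed.

(** If [F] were unbounded, monotonicity would push [P] above every level near [D]. Power above
    equilibrium keeps T below [Tc] on a final stretch after the last arrival, with [D] excluded, and
    there the huge late power could be advanced to instants where [P] is at most [F t0]. *)
Lemma weighted_bounded (Y : set R) : {ae mu, forall u, u \in `]0, D[ -> Y u} ->
  Y `<=` `]0, D[ -> (forall u v, Y u -> Y v -> u < v -> F u <= F v) ->
  exists C, forall u, Y u -> F u <= C.
Proof.
move=> aeY YD ndF; apply: contrapT => unb.
have Fae := ae_filter_ringOfSetsType mu.
(* Once [F] exceeds exp (b D) (1 + p) it stays above it, and exp (b v) <= exp (b D) then forces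
   [P v] above [p]. *)
have large p : exists2 u, u < D & {ae mu, forall v, v \in `]u, D[ -> p <= P v}.
  have [u [Yu Fu]] : exists u, Y u /\ expR (b * D) * (1 + p) < F u.
    apply: contrapT => nou; apply: unb; exists (expR (b * D) * (1 + p)) => u Yu.
    by rewrite leNgt; apply/negP => Fu; apply: nou; exists u.
  have := YD _ Yu; rewrite /= in_itv/= => /andP[u0 uD]; exists u => //.
  apply: filterS aeY => v + vI; move: (vI); rewrite !in_itv/= => /andP[uv vD].
  rewrite vD (lt_trans u0 uv) => /(_ isT) Yv.
  have := lt_le_trans Fu (ndF _ _ Yu Yv uv).
  rewrite leNgt; apply: contraTN => Pvp; rewrite -leNgt /F.
  have P0 : 0 <= P v by apply: (optimal_ge0 P_opt); rewrite in_itv/= !ltW// (lt_trans u0).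
  by apply: ler_pM; rewrite ?expR_ge0 ?addr_ge0 ?ler_expR ?ler_pM2l ?lerD2l//; exact: ltW.
have [u1 u1D hot] := large (b * (Tc - Te) / a + 1).
pose x0 := Num.max u1 (s N).
have sND : s N < D by rewrite -s_end s_incr.
have x0D : x0 < D by rewrite gt_max u1D sND.
have x0_ge0 : 0 <= x0 by rewrite le_max (arrival_ge0 (leqnSn N)) orbT.
have cold t : x0 <= t -> t < D -> temperature a b Te P t < Tc.
  move=> x0t tD; apply: (heating_lt_Tc D_gt0 a_gt0 b_gt0 P_opt Te_lt_Tc
    (le_trans x0_ge0 x0t) tD (lexx D) (p := b * (Tc - Te) / a + 1)).
    by rewrite ltrDl.
  apply: filterS hot => v + vI; apply; move: vI; rewrite !in_itv/= => /andP[tv ->].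
  by rewrite andbT (le_lt_trans _ tv)// (le_trans _ x0t)// le_max lexx.
have [t0 t0I Yt0] := ae_itv_exists x0D aeY.
move: t0I; rewrite in_itv/= => /andP[x0t0 t0D].
have {}Yt0 : Y t0 by apply: Yt0; rewrite in_itv/= t0D (le_lt_trans x0_ge0).
have [u2 u2D large2] := large (F t0 + 1).
pose t1 := Num.max t0 u2.
have t1D : t1 < D by rewrite gt_max t0D u2D.
have t0t1 : t0 <= t1 by rewrite le_max lexx.
have u2t1 : u2 <= t1 by rewrite le_max lexx orbT.
(* T may reach [Tc] at [D] itself, so the giving interval stops halfway between [t1] and [D]. *)
apply: (@advance_absurd N x0 t0 t1 ((t1 + D) / 2) (F t0) (F t0 + 1)) => //.
- by rewrite le_max lexx orbT.
- lra.
- by rewrite s_end; lra.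
- by move=> t; rewrite in_itv/= => /andP[x0t tt]; apply: cold => //; lra.
- by rewrite ltrDl.
- apply: filterS aeY => u uY; rewrite in_itv/= => /andP[x0u ut0].
  have u_gt0 : 0 < u by apply: le_lt_trans x0u.
  have uD : u < D by apply: lt_trans t0D.
  have {}uY : Y u by apply: uY; rewrite in_itv/= u_gt0.
  apply: le_trans (ndF _ _ uY Yt0 ut0); rewrite /F.
  have P0 : 0 <= P u by apply: (optimal_ge0 P_opt); rewrite in_itv/= !ltW.
  apply: (@le_trans _ _ (1 + P u)); first by rewrite lerDr.
  by rewrite ler_peMl ?addr_ge0// -expR0 ler_expR mulr_ge0// ltW.
- apply: filterS large2 => u uP; rewrite in_itv/= => /andP[tu ut].
  by apply: uP; rewrite in_itv/=; apply/andP; split; lra.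
Qed.

End jumps.

(** * The regular representative *)

(** Constraints and objective are integrals, blind to null sets. Only measurability and pointwise
    nonnegativity must be supplied for [Q]. *)
Lemma ae_eq_optimal (R : realType) (D a b Te Tc : R) (N : nat) (s E : nat -> R)
    (P Q : R -> R) : optimal_policy D a b Te Tc N s E P -> power_policy D Q ->
  {ae lebesgue_measure, forall t, t \in `[0, D] -> Q t = P t} ->
  optimal_policy D a b Te Tc N s E Q.
Proof.
move=> [[[mP P0] cold causal] opt] [mQ Q0] aeQP.
have int_eq (g : R -> R -> R) t : t <= D ->
    measurable_fun `[0, t] (fun u => g u (P u)) ->
    measurable_fun `[0, t] (fun u => g u (Q u)) ->
    (\int[lebesgue_measure]_(u in `[0%R, t]) (g u (Q u))%:E =
     \int[lebesgue_measure]_(u in `[0%R, t]) (g u (P u))%:E)%E.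
  move=> tD mgP mgQ; apply: ae_eq_integral => //.
  - exact/measurable_EFinP.
  - exact/measurable_EFinP.
  have Fae := ae_filter_ringOfSetsType (@lebesgue_measure R).
  by apply: filterS aeQP => u QPu ut; rewrite QPu//; exact: subitv0 ut.
have mS (f : R -> R) t : t <= D -> measurable_fun `[0, D] f -> measurable_fun `[0, t] f.
  by move=> tD; apply: measurable_funS => //; exact: subitv0.
have mexp (f : R -> R) (t : R) : measurable_fun `[0, t] f ->
    measurable_fun `[0, t] (fun u => a * expR (b * u) * f u).
  move=> mf; apply: measurable_funM => //; apply: measurable_funM => //.
  exact: measurableT_comp.
have mln (f : R -> R) : measurable_fun `[0, D] f ->
    measurable_fun `[0, D] (fun u => 2^-1 * (ln (1 + f u) / ln 2)).
  move=> mf; apply: measurable_funM => //; apply: measurable_funM => //.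
  by apply: measurableT_comp => //; exact: measurable_funD.
split; last first.
  move=> P' /opt; rewrite /throughput => /le_trans; apply; rewrite le_eqVlt.
  by rewrite (int_eq (fun _ z => 2^-1 * (ln (1 + z) / ln 2)) D (lexx D)) ?eqxx//; exact: mln.
split=> // t tD.
  rewrite (_ : temperature a b Te Q t = temperature a b Te P t) ?cold//.
  move: tD; rewrite in_itv/= => /andP[_ tD].
  congr (_ + _ * _); congr fine.
  by apply: (int_eq (fun u z => a * expR (b * u) * z)) => //; apply: mexp; exact: mS.
apply: le_trans (causal _ tD); move: tD; rewrite in_itv/= => /andP[_ tD].
by rewrite (int_eq (fun _ z => z))//; exact: mS.
Qed.

(** [H t] is the supremum of [F] over the points of [Y] before [t], with the infimum [m0] adjoined
    so that the set is never empty. Thus [H 0] is the infimum and [H D] the supremum of [F] on [Y];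
    the last two clauses record this and yield continuity of [H] at the ends of [[0, D]]. *)
Lemma monotone_extension (R : realType) (D m M : R) (Y : set R) (F : R -> R) :
  Y !=set0 -> Y `<=` `]0, D[ -> (forall u v, Y u -> Y v -> u < v -> F u <= F v) ->
  (forall u, Y u -> m <= F u <= M) ->
  exists H : R -> R, [/\ {homo H : x y / x <= y},
    forall u v, Y u -> u < v -> F u <= H v,
    forall u v, Y v -> u <= v -> H u <= F v,
    forall e, 0 < e -> exists2 u, Y u & F u < H 0 + e
    & forall e, 0 < e -> exists2 u, Y u & H D - e < F u].
Proof.
move=> [y0 Yy0] YD ndF FM; pose m0 := inf (F @` Y).
pose S t := m0 |` F @` (Y `&` [set u | u < t]).
have infY : has_inf (F @` Y).
  split; first by exists (F y0), y0.
  by exists m => _ [u Yu <-]; case/andP: (FM _ Yu).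
have m0F u : Y u -> m0 <= F u by move=> Yu; apply: ge_inf; [case: infY|exists u].
have supS t : has_sup (S t).
  split; first by exists m0; left.
  exists M => _ [->|[u [Yu _] <-]]; last by case/andP: (FM _ Yu).
  by rewrite (le_trans (m0F _ Yy0))//; case/andP: (FM _ Yy0).
have S0 : S 0 = [set m0].
  rewrite /S [X in _ |` X](_ : _ = set0) ?setU0//.
  rewrite -subset0 => _ [u [/YD + /= u0] _]; rewrite /= in_itv/= => /andP[].
  by move=> /lt_trans/(_ u0); rewrite ltxx.
exists (fun t => sup (S t)); split.
- move=> x y xy; apply: ge_sup; first by case: (supS x).
  move=> z [->|[u [Yu /= ux] <-]]; apply: ub_le_sup; try by case: (supS y).
    by left.
  by right; exists u => //; split => //=; exact: lt_le_trans xy.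
- move=> u v Yu uv; apply: ub_le_sup; first by case: (supS v).
  by right; exists u.
- move=> u v Yv uv; apply: ge_sup; first by case: (supS u).
  move=> z [->|[w [Yw /= wu] <-]]; first exact: m0F.
  by apply: ndF => //; exact: lt_le_trans uv.
- move=> e e0; rewrite S0 sup1.
  by have [_ [u Yu <-]] := inf_adherent e0 infY; exists u.
- move=> e e0; have [z [->|[u [Yu _] <-]]] := sup_adherent e0 (supS D).
    by exists y0 => //; apply: lt_le_trans (m0F _ Yy0).
  by exists u.
Qed.

Lemma nondecreasing_limits (R : realType) (H : R -> R) (t : R) :
  {homo H : x y / x <= y} -> exists l r : R,
  [/\ H x @[x --> t^'-] --> l, H x @[x --> t^'+] --> r, l <= H t <= r,
      forall u, u < t -> H u <= l & forall v, t < v -> r <= H v].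
Proof.
move=> ndH; pose l := lim (H x @[x --> t^'-]); pose r := lim (H x @[x --> t^'+]).
have cvl : H x @[x --> t^'-] --> l.
  apply: nondecreasing_at_left_is_cvgr.
    by apply: nearW => x y z _ _; exact: ndH.
  apply: nearW => x; exists (H t) => _ [y + <-]; rewrite /= in_itv/= => /andP[_ yt].
  exact/ndH/ltW.
have cvr : H x @[x --> t^'+] --> r.
  apply: nondecreasing_at_right_is_cvgr.
    by apply: nearW => x y z _ _; exact: ndH.
  apply: nearW => x; exists (H t) => _ [y + <-]; rewrite /= in_itv/= => /andP[ty _].
  exact/ndH/ltW.
exists l, r; split => //.
- apply/andP; split.
    apply: limr_le; first exact: cvl.
    by near=> x; apply/ndH/ltW.
  apply: limr_ge; first exact: cvr.
  by near=> x; apply/ndH/ltW.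
- move=> u ut; apply: limr_ge; first exact: cvl.
  by near=> x; apply/ndH/ltW.
- move=> v tv; apply: limr_le; first exact: cvr.
  by near=> x; apply/ndH/ltW.
Unshelve. all: by end_near. Qed.

Lemma between_arrivals (R : realDomainType) (N : nat) (s : nat -> R) (t : R) :
  s 0%N < t -> t < s N.+1 -> (forall k, (1 <= k <= N)%N -> t != s k) ->
  exists k, [/\ (k <= N)%N, s k < t & t < s k.+1].
Proof.
move=> s0t tsN ts; have noarr k : (k <= N)%N -> t != s k.+1.
  rewrite leq_eqVlt => /predU1P[->|kN]; first by rewrite lt_eqF.
  by apply: ts.
suff below k : (k <= N.+1)%N ->
    (exists j, [/\ (j <= N)%N, s j < t & t < s j.+1]) \/ s k < t.
  by have [//|/lt_trans/(_ tsN)] := below N.+1 (leqnn _); rewrite ltxx.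
elim: k => [|k IHk] kN; first by right.
have [?|skt] := IHk (ltnW kN); first by left.
have [tsk|skt'|tsk] := ltgtP t (s k.+1).
- by left; exists k.
- by right.
- by have := noarr k kN; rewrite tsk eqxx.
Qed.

Section main.
Context {R : realType}.
Local Notation mu := (@lebesgue_measure R).
Variables (D a b Te Tc : R) (N : nat) (s E : nat -> R) (P : R -> R).
Hypotheses (D_gt0 : 0 < D) (a_gt0 : 0 < a) (b_gt0 : 0 < b) (Te_lt_Tc : Te < Tc).
Hypotheses (s_0 : s 0%N = 0) (s_incr : forall k, (k <= N)%N -> s k < s k.+1)
  (s_end : s N.+1 = D).
Hypothesis P_opt : optimal_policy D a b Te Tc N s E P.

Let F u := expR (b * u) * (1 + P u).

Let PE u : P u = expR (- (b * u)) * F u - 1.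
Proof. by rewrite /F mulrA expRN mulVf ?gt_eqF ?expR_gt0// mul1r addrC addKr. Qed.

Section profile.
Variables (Y : set R) (H : R -> R).
Hypotheses (aeY : {ae mu, forall u, u \in `]0, D[ -> Y u}) (YD : Y `<=` `]0, D[).
Hypotheses (ndH : {homo H : x y / x <= y})
  (FH : forall u v, Y u -> u < v -> F u <= H v)
  (HF : forall u v, Y v -> u <= v -> H u <= F v).

(** Recovers a power from [H] as [PE] recovers [P] from [F]. The exponential is continuous and
    positive, so [Q] inherits one-sided limits and the sign of jumps from [H]. *)
Let Q (t : R) := expR (- (b * t)) * H t - 1.

Let cvg_profile (G : set_system R) (h : R -> R) (t l : R) : Filter G ->
  x @[x --> G] --> t -> h x @[x --> G] --> l ->
  expR (- (b * x)) * h x - 1 @[x --> G] --> expR (- (b * t)) * l - 1.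
Proof.
move=> FG Gt hl; apply: cvgB; last exact: cvg_cst.
apply: cvgM => //; apply: continuous_cvg; first exact: continuous_expR.
by apply: cvgN; apply: cvgMr.
Qed.

(** A gap of [H] at [t] would separate the values of [P] on the two sides of [t], almost everywhere,
    which [no_jump] excludes between arrivals. *)
Lemma profile_no_jump (t l r : R) : 0 < t -> t < D ->
  (forall k, (1 <= k <= N)%N -> t != s k) ->
  (forall u, u < t -> H u <= l) -> (forall v, t < v -> r <= H v) -> ~ (l < r).
Proof.
move=> t0 tD ts Hl rH lr.
have [||k [kN skt tsk]] := between_arrivals _ _ ts.
- by rewrite s_0.
- by rewrite s_end.
have Fae := ae_filter_ringOfSetsType mu.
pose L := expR (- (b * t)) * l - 1; pose L' := expR (- (b * t)) * r - 1.
have LL' : L < L' by rewrite ltrD2r ltr_pM2l ?expR_gt0.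
have cvgc (c : R) : expR (- (b * x)) * c - 1 @[x --> t] --> expR (- (b * t)) * c - 1.
  by apply: (@cvg_profile _ (fun=> c)); [exact: cvg_id|exact: cvg_cst].
(* The outer thirds of the gap absorb the variation of exp (- b u) near [t]; the middle third
   separates [p] from [p']. *)
have Lp : L < L + (L' - L) / 3 by lra.
have p'L : L + (L' - L) * 2 / 3 < L' by lra.
have [e1 /= e1_gt0 near1] := cvgr_lt _ (cvgc l) _ Lp.
have [e2 /= e2_gt0 near2] := cvgr_gt _ (cvgc r) _ p'L.
apply: (@no_jump _ D a b Te Tc N s E P D_gt0 a_gt0 b_gt0 Te_lt_Tc s_0 s_incr s_end P_opt
  k t (Num.max 0 (t - e1)) (Num.min D (t + e2)) (L + (L' - L) / 3) (L + (L' - L) * 2 / 3)) => //.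
- by rewrite gt_max t0/=; lra.
- by rewrite lt_min tD/=; lra.
- by lra.
- apply: filterS aeY => u uY; rewrite in_itv/= gt_max => /andP[/andP[u0 eu] ut].
  have {}uY : Y u by apply: uY; rewrite in_itv/= u0 (lt_trans ut).
  rewrite ltW// PE; apply: le_lt_trans (near1 u _); last first.
    by rewrite /= ltr_norml; apply/andP; split; lra.
  rewrite lerD2r ler_pM2l ?expR_gt0//.
  (* The midpoint serves because [FH] needs an argument strictly after [u] and [Hl] one strictly
     before [t]. *)
  by apply: (@le_trans _ _ (H ((u + t) / 2))); [apply: FH|apply: Hl] => //; lra.
- apply: filterS aeY => u uY; rewrite in_itv/= lt_min => /andP[tu /andP[uD ue]].
  have {}uY : Y u by apply: uY; rewrite in_itv/= uD (lt_trans t0).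
  rewrite ltW// PE; apply: lt_le_trans (near2 u _) _.
    by rewrite /= ltr_norml; apply/andP; split; lra.
  rewrite lerD2r ler_pM2l ?expR_gt0//.
  by apply: (@le_trans _ _ (H u)); [exact: rH|exact: HF].
Qed.

(** Away from the countably many [s k] the limits of [H] agree, so H u <= F u <= r = l <= H u. *)
Lemma profile_ae_eq : {ae mu, forall t, t \in `[0, D] -> Q t = P t}.
Proof.
have Fae := ae_filter_ringOfSetsType mu.
(* All indices are taken, so [s 0 = 0] and [s N.+1 = D] are avoided as well. *)
have ae_s : {ae mu, forall u, forall k : nat, u <> s k}.
  by apply: ae_forall_countable => k; exact: ae_neq.
apply: filterS2 aeY ae_s => u uY us; rewrite in_itv/= => /andP[u0 uD].
have {}u0 : 0 < u by rewrite lt_neqAle u0 andbT eq_sym -s_0; exact/eqP/us.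
have {}uD : u < D by rewrite lt_neqAle uD andbT -s_end; exact/eqP/us.
have {}uY : Y u by apply: uY; rewrite in_itv/= u0.
rewrite PE /Q; congr (_ * _ - 1); apply/eqP; rewrite eq_le HF//=.
have [l [r [_ cvr /andP[lHr Hr] Hl rH]]] := nondecreasing_limits u ndH.
have lr : l = r.
  apply/eqP; rewrite eq_le (le_trans lHr Hr)/= leNgt; apply/negP.
  apply: (@profile_no_jump u) => // k _; exact/eqP/us.
apply: le_trans (_ : r <= H u); last by rewrite -lr.
by apply: (cvgr_to_ge cvr); apply: filterS (nbhs_right_gt u) => v; exact: FH.
Qed.

Hypotheses (H0 : forall e, 0 < e -> exists2 u, Y u & F u < H 0 + e)
  (HD : forall e, 0 < e -> exists2 u, Y u & H D - e < F u).

(** At 0 and [D] continuity relative to [[0, D]] comes from [H0] and [HD], so only interior points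
    need the extra hypothesis. *)
Lemma profile_cvg (t : R) : t \in `[0, D] ->
  (0 < t < D -> H x @[x --> t] --> H t) ->
  H x @[x --> within `[0, D] (nbhs t)] --> H t.
Proof.
rewrite in_itv/= => /andP[t0 tD] Ht.
have [t_gt0|t_le0] := ltP 0 t; last first.
  have {t0 t_le0 Ht tD} -> : t = 0 by apply/eqP; rewrite eq_le t_le0.
  apply/cvgrPdist_lt => e e0; have [u Yu Fu] := H0 e0.
  have := YD Yu; rewrite /= in_itv/= => /andP[u0 _].
  apply: filterS (lt_nbhsl u0) => v vu; rewrite /= in_itv/= => /andP[v0 _].
  rewrite ltr_norml; have := ndH v0; have := HF Yu (ltW vu).
  by move=> *; apply/andP; split; lra.
have [t_ltD|D_let] := ltP t D; last first.
  have {t0 t_gt0 Ht tD D_let} -> : t = D by apply/eqP; rewrite eq_le tD.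
  apply/cvgrPdist_lt => e e0; have [u Yu Fu] := HD e0.
  have := YD Yu; rewrite /= in_itv/= => /andP[_ uD].
  apply: filterS (lt_nbhsr uD) => v uv; rewrite /= in_itv/= => /andP[_ vD].
  rewrite ltr_norml; have := ndH vD; have := FH Yu uv.
  by move=> *; apply/andP; split; lra.
apply: cvg_within_filter; apply: Ht; exact/andP.
Qed.

(** If the one-sided limits of [H] coincide they equal [H t], and [Q] is continuous. A discontinuity
    is thus interior with l < r, and [profile_no_jump] makes it an arrival. *)
Lemma profile_discontinuous (t : R) : discontinuous_at D Q t ->
  positive_jump Q t /\ exists k : nat, (1 <= k <= N)%N /\ t = s k.
Proof.
move=> [tD Qt].
have [l [r [cvl cvr /andP[lHt Htr] Hl rH]]] := nondecreasing_limits t ndH.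
have Hnot : 0 < t < D /\ l < r.
  apply: contrapT => nlr; apply: Qt; apply: cvg_profile.
    exact: cvg_within.
  apply: profile_cvg => // t0D.
  have lr : l = r.
    apply/eqP; rewrite eq_le (le_trans lHt Htr)/= leNgt; apply/negP => lr.
    by apply: nlr.
  have lH : l = H t by apply/eqP; rewrite eq_le lHt lr Htr.
  apply/left_right_continuousP.
  by split; [rewrite -lH|rewrite -lH lr].
move: Hnot => [/andP[t0 t_ltD] lr]; split.
  exists (expR (- (b * t)) * l - 1), (expR (- (b * t)) * r - 1); split.
  - apply: cvg_profile => //; apply: cvg_at_left_filter; exact: cvg_id.
  - apply: cvg_profile => //; apply: cvg_at_right_filter; exact: cvg_id.
  - by rewrite ltrD2r ltr_pM2l ?expR_gt0.
apply: contrapT => nok; apply: (profile_no_jump t0 t_ltD _ Hl rH lr) => k kN.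
by apply/eqP => tk; apply: nok; exists k.
Qed.

(** A policy must be nonnegative at every point, also off [Y]. The bound F u >= exp (b u) passes
    from [Y] to [H]: through the infimum at 0, and elsewhere through points of [Y] just before
    [t]. *)
Lemma profile_ge0 t : t \in `[0, D] -> 0 <= Q t.
Proof.
rewrite in_itv/= => /andP[t0 tD].
have F_ge u : Y u -> expR (b * u) <= F u.
  move=> /YD; rewrite /= in_itv/= => /andP[u0 uD].
  by rewrite ler_peMr ?expR_ge0// lerDl (optimal_ge0 P_opt)// in_itv/= !ltW.
rewrite subr_ge0 expRN ler_pdivlMl ?expR_gt0// mulr1.
have [t_gt0|t_le0] := ltP 0 t; last first.
  have {t0 t_le0 tD} -> : t = 0 by apply/eqP; rewrite eq_le t_le0.
  rewrite mulr0 expR0; apply/ler_addgt0Pr => e e0; have [u Yu Fu] := H0 e0.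
  apply: le_trans (ltW Fu); apply: le_trans (F_ge _ Yu).
  have := YD Yu; rewrite /= in_itv/= => /andP[u0 _].
  by rewrite -expR0 ler_expR mulr_ge0// ltW.
rewrite leNgt; apply/negP => Ht.
have expc : expR (b * x) @[x --> t] --> expR (b * t).
  by apply: continuous_cvg; [exact: continuous_expR|exact: cvgMr].
have [e /= e0 near_t] := cvgr_gt _ expc _ Ht.
have ct : Num.max 0 (t - e) < t by rewrite gt_max t_gt0/=; lra.
have [u] := ae_itv_exists ct aeY; rewrite !in_itv/= gt_max => /andP[/andP[u0 eu] ut].
rewrite u0 (lt_le_trans ut tD) => /(_ isT) Yu.
have : H t < expR (b * u) by apply: near_t => /=; rewrite ltr_norml; apply/andP; split; lra.
by rewrite ltNge (le_trans (F_ge _ Yu))// FH.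
Qed.

End profile.
End main.

Theorem lemma7 (R : realType) (D a b Te Tc : R) (N : nat) (s E : nat -> R)
    (D_gt0 : 0 < D) (a_gt0 : 0 < a) (b_gt0 : 0 < b) (Te_lt_Tc : Te < Tc)
    (E_gt0 : forall i, (i <= N)%N -> 0 < E i)
    (s_0 : s 0%N = 0)
    (s_incr : forall k, (k <= N)%N -> s k < s k.+1)
    (s_end : s N.+1 = D)
    (P : R -> R) (P_opt : optimal_policy D a b Te Tc N s E P) :
  (exists Q : R -> R,
    [/\ {ae lebesgue_measure, forall t, t \in `[0, D] -> Q t = P t},
        optimal_policy D a b Te Tc N s E Q
      & forall t, discontinuous_at D Q t ->
          positive_jump Q t /\
          exists k : nat, (1 <= k <= N)%N /\ t = s k]) /\
  {within `[0, D], continuous (temperature a b Te P)}.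
Proof.
split; last first.
  exact/temperature_continuous/(optimal_integrable D_gt0 P_opt).
have [Y [aeY YD ndF]] := ae_monotone D_gt0 a_gt0 b_gt0 P_opt.
have [C FC] := weighted_bounded D_gt0 a_gt0 b_gt0 Te_lt_Tc s_0 s_incr s_end P_opt
  aeY YD ndF.
have Y0 : Y !=set0.
  by have [u uD Yu] := ae_itv_exists D_gt0 aeY; exists u; exact: Yu.
have F_bnd u : Y u -> 0 <= expR (b * u) * (1 + P u) <= C.
  move=> Yu; rewrite FC// andbT mulr_ge0 ?expR_ge0// addr_ge0//.
  by apply: (optimal_ge0 P_opt); apply: subset_itv_oo_cc; exact: YD.
have [H [ndH FH HF H0 HD]] := monotone_extension Y0 YD ndF F_bnd.
have QP := profile_ae_eq D_gt0 a_gt0 b_gt0 Te_lt_Tc s_0 s_incr s_end P_opt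
  aeY ndH FH HF.
exists (fun t => expR (- (b * t)) * H t - 1); split => //.
  apply: (ae_eq_optimal P_opt _ QP); split; last first.
    exact: (profile_ge0 b_gt0 P_opt aeY YD FH H0).
  apply: measurable_funB => //; apply: measurable_funM.
    by apply: measurableT_comp => //; apply: measurableT_comp => //; exact: measurable_funM.
  exact: nondecreasing_measurable.
by move=> t; exact: (profile_discontinuous D_gt0 a_gt0 b_gt0 Te_lt_Tc s_0 s_incr s_end
  P_opt aeY YD ndH FH HF H0 HD).
Qed.
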